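(* Let $\phi(x)=\frac{ax+b}{cx+d}$ with $a,b,c,d\in\mathbb{Q}_2$, $ad-bc\ne0$, let $\Delta=(d-a)^2+4bc$ and assume $\sqrt{\Delta}\notin\mathbb{Q}_2$. Let $K=\mathbb{Q}_2(\sqrt{\Delta})$, let $\pi$ be a uniformizer of $K$, and suppose that $\lambda=\frac{a+d+\sqrt{\Delta}}{a+d-\sqrt{\Delta}}\in K$ is not a root of unity. Assume $K=\mathbb{Q}_2(\sqrt{2}),\ \mathbb{Q}_2(\sqrt{-2}),\ \mathbb{Q}_2(\sqrt{6})$ or $\mathbb{Q}_2(\sqrt{-6})$. Then $|\sqrt{\Delta}|_2\ne|a+d|_2$, and: (1) If $|a+d|_2>|\sqrt{\Delta}|_2$, then the dynamical system $(\mathbb{P}^1(\mathbb{Q}_2),\phi)$ is decomposed into $2^{(v_\pi(\lambda-1)-1)/2}$ minimal subsystems. (2) If $|a+d|_2<|\sqrt{\Delta}|_2$, then the dynamical system $(\mathbb{P}^1(\mathbb{Q}_2),\phi)$ is decomposed into $2^{(v_\pi(\lambda+1)-1)/2}$ minimal subsystems. In both cases, each minimal subsystem is topologically conjugate to the adding machine on the odometer $\mathbb{Z}_{(p_s)}$ with $(p_s)=(1,2,2^2,\cdots)$.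
   Context: $\mathbb{P}^1(\mathbb{Q}_2)=\mathbb{Q}_2\cup\{\infty\}$ with its usual compact topology. $|\cdot|_2$ and $v_2=-\log_2|\cdot|_2$ are extended to $K$; $v_\pi:=e\,v_2$ where $e$ is the ramification index of $K/\mathbb{Q}_2$ (here $e=2$, so $v_\pi(\pi)=1$). A subsystem is a pair $(E,\phi)$ with $E$ compact and $\phi(E)\subset E$; it is minimal if $E=\overline{\{\phi^n(x):n\ge 0\}}$ for every $x\in E$. ''Decomposed into $M$ minimal subsystems'' means that $\mathbb{P}^1(\mathbb{Q}_2)$ is the disjoint union of $M$ nonempty compact $\phi$-invariant sets, on each of which $\phi$ is minimal. For positive integers $p_s\mid p_{s+1}$ $(s\ge1)$, the odometer $\mathbb{Z}_{(p_s)}$ is the inverse limit of $\mathbb{Z}/p_s\mathbb{Z}$, and the adding machine is $x\mapsto x+1$ on it. *)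

(* Defs.v *)
From HB Require Import structures.
From mathcomp Require Import all_boot all_order all_algebra all_field.
From mathcomp Require Import generic_quotient fraction.
From mathcomp Require Import all_classical all_reals all_analysis.

Set Implicit Arguments.
Unset Strict Implicit.
Unset Printing Implicit Defensive.

Import Order.TTheory GRing.Theory Num.Theory.
Local Open Scope classical_set_scope.
Local Open Scope ring_scope.

(* The 2-adic integers are the inverse limit of the rings Z/2^n; the residue
   mod 2^n is represented by an integer in [0, 2^n[, which is what the
   coherence condition forces since %% is the nonnegative remainder. *)

Definition pow2 (n : nat) : int := 2 ^+ n.

Record Z2 := MkZ2 {
  digits :> nat -> int ;
  digitsP : forall n, digits n = (digits n.+1 %% pow2 n)%Z }.

HB.instance Definition _ := gen_eqMixin Z2.
HB.instance Definition _ := gen_choiceMixin Z2.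

Lemma pow2_neq0 n : pow2 n != 0.
Proof. by rewrite expf_neq0. Qed.

Lemma dvd_pow2 m n : (m <= n)%N -> (pow2 m %| pow2 n)%Z.
Proof. by move=> mn; rewrite /pow2 -(subnK mn) exprD dvdz_mull. Qed.

Lemma modz_pow2 (z : int) m n : (m <= n)%N ->
  ((z %% pow2 n)%Z %% pow2 m)%Z = (z %% pow2 m)%Z.
Proof.
move=> /dvd_pow2/dvdzP[q qE].
by rewrite [in RHS](divz_eq z (pow2 n)) [X in _ * X + _]qE mulrA modzMDl.
Qed.

Lemma Z2_ext (x y : Z2) : (forall n, x n = y n) -> x = y.
Proof.
case: x y => [x hx] [y hy] /= /funext xy.
by rewrite {}xy in hx *; congr MkZ2; exact: Prop_irrelevance.
Qed.

Lemma Z2_coh (x : Z2) m n : (m <= n)%N -> x m = (x n %% pow2 m)%Z.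
Proof.
move=> /subnK <-; elim: (n - m)%N => [|k IH].
  by rewrite add0n [LHS]digitsP [X in _ = (X %% _)%Z]digitsP modz_mod -digitsP.
by rewrite IH addSn (digitsP x (k + m)) modz_pow2// leq_addl.
Qed.

Lemma Z2_of_subproof (f : nat -> int) :
    (forall n, (f n = f n.+1 %[mod pow2 n])%Z) ->
  forall n, (f n %% pow2 n)%Z = ((f n.+1 %% pow2 n.+1)%Z %% pow2 n)%Z.
Proof. by move=> fP n; rewrite modz_pow2. Qed.

Definition Z2_of (f : nat -> int)
    (fP : forall n, (f n = f n.+1 %[mod pow2 n])%Z) : Z2 :=
  MkZ2 (Z2_of_subproof fP).

Section Z2_ops.
Implicit Types x y : Z2.

Fact Z2_const_subproof (z : int) n : (z = z %[mod pow2 n])%Z.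
Proof. by []. Qed.

Fact Z2_add_subproof x y n :
  (x n + y n = x n.+1 + y n.+1 %[mod pow2 n])%Z.
Proof. by rewrite (digitsP x) (digitsP y) modzDm. Qed.

Fact Z2_opp_subproof x n : (- x n = - x n.+1 %[mod pow2 n])%Z.
Proof. by rewrite (digitsP x) modzNm. Qed.

Fact Z2_mul_subproof x y n :
  (x n * y n = x n.+1 * y n.+1 %[mod pow2 n])%Z.
Proof. by rewrite (digitsP x) (digitsP y) modzMm. Qed.

Definition Z2_const z := Z2_of (Z2_const_subproof z).
Definition Z2_add x y := Z2_of (Z2_add_subproof x y).
Definition Z2_opp x := Z2_of (Z2_opp_subproof x).
Definition Z2_mul x y := Z2_of (Z2_mul_subproof x y).

Lemma Z2_red x n : (x n %% pow2 n)%Z = x n.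
Proof. by rewrite -(Z2_coh x (leqnn n)). Qed.

Fact Z2_addA : associative Z2_add.
Proof. by move=> x y z; apply: Z2_ext => n /=; rewrite modzDmr modzDml addrA. Qed.
Fact Z2_addC : commutative Z2_add.
Proof. by move=> x y; apply: Z2_ext => n /=; rewrite addrC. Qed.
Fact Z2_add0 : left_id (Z2_const 0) Z2_add.
Proof. by move=> x; apply: Z2_ext => n /=; rewrite mod0z add0r Z2_red. Qed.
Fact Z2_addN : left_inverse (Z2_const 0) Z2_opp Z2_add.
Proof. by move=> x; apply: Z2_ext => n /=; rewrite modzDml addNr. Qed.
Fact Z2_mulA : associative Z2_mul.
Proof. by move=> x y z; apply: Z2_ext => n /=; rewrite modzMmr modzMml mulrA. Qed.
Fact Z2_mulC : commutative Z2_mul.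
Proof. by move=> x y; apply: Z2_ext => n /=; rewrite mulrC. Qed.
Fact Z2_mul1 : left_id (Z2_const 1) Z2_mul.
Proof. by move=> x; apply: Z2_ext => n /=; rewrite modzMml mul1r Z2_red. Qed.
Fact Z2_mulD : left_distributive Z2_mul Z2_add.
Proof.
by move=> x y z; apply: Z2_ext => n /=; rewrite modzMml modzDml modzDmr mulrDl.
Qed.
Fact Z2_1neq0 : Z2_const 1 != Z2_const 0.
Proof. by apply/eqP => /(congr1 (fun x : Z2 => x 1%N)). Qed.

End Z2_ops.

HB.instance Definition _ :=
  GRing.isZmodule.Build Z2 Z2_addA Z2_addC Z2_add0 Z2_addN.
HB.instance Definition _ := GRing.Zmodule_isComNzRing.Build Z2
  Z2_mulA Z2_mulC Z2_mul1 Z2_mulD Z2_1neq0.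

Definition Z2_unit : {pred Z2} := fun x => `[< exists y : Z2, y * x = 1 >].
Definition Z2_inv (x : Z2) : Z2 :=
  if pselect (exists y : Z2, y * x = 1) is left h then projT1 (cid h) else x.

Fact Z2_mulVr : {in Z2_unit, left_inverse 1 Z2_inv *%R}.
Proof.
move=> x /asboolP xU; rewrite /Z2_inv; case: pselect => // h.
by case: cid.
Qed.
Fact Z2_unitP (x y : Z2) : y * x = 1 -> x \in Z2_unit.
Proof. by move=> yx; apply/asboolP; exists y. Qed.
Fact Z2_inv_out : {in [predC Z2_unit], Z2_inv =1 id}.
Proof.
move=> x; rewrite !inE => /asboolP xU; rewrite /Z2_inv.
by case: pselect => // h; case: xU.
Qed.

HB.instance Definition _ := GRing.ComNzRing_hasMulInverse.Build Z2
  Z2_mulVr Z2_unitP Z2_inv_out.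

Lemma Z2_0E n : (0 : Z2) n = 0. Proof. exact: mod0z. Qed.

Lemma dvd_digits (x : Z2) m n : (m <= n)%N ->
  (pow2 m %| x n)%Z = (x m == 0).
Proof. by move=> mn; rewrite (Z2_coh x mn); apply/dvdz_mod0P/eqP. Qed.

Lemma Z2_neq0_ex (x : Z2) : x != 0 -> exists n, x n != 0.
Proof.
move=> x0; apply: contrapT => h.
move/eqP: x0; apply; apply: Z2_ext => n; rewrite Z2_0E.
by apply: contrapT => /eqP xn; apply: h; exists n.
Qed.

(* For x <> 0, the largest n such that 2^n divides x; the value at 0 is
   irrelevant. *)
Definition Z2_val (x : Z2) : nat :=
  if pselect (exists n, x n != 0) is left h then (ex_minn h).-1 else 0%N.

Lemma Z2_valP (x : Z2) : x != 0 -> x (Z2_val x) = 0 /\ x (Z2_val x).+1 != 0.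
Proof.
move=> /Z2_neq0_ex h; rewrite /Z2_val; case: pselect => // {}h.
case: ex_minnP => -[|n] xn hn /=.
  by move: xn; rewrite -(Z2_red x 0) /pow2 expr0 modz1 eqxx.
split=> //; apply/eqP; apply/negPn/negP => /hn; by rewrite ltnn.
Qed.

Lemma Z2_val_dvd (x : Z2) n : x != 0 -> (x n == 0) = (n <= Z2_val x)%N.
Proof.
move=> /Z2_valP[x0 x1]; apply/idP/idP => [xn|nv].
  rewrite leqNgt; apply/negP => vn; move/negP: x1; apply.
  by rewrite -(dvd_digits x vn) (eqP xn) dvdz0.
rewrite -(dvd_digits x nv); by rewrite x0 dvdz0.
Qed.

Lemma Z2_mul_val (x y : Z2) : x != 0 -> y != 0 ->
  (x * y) (Z2_val x + Z2_val y)%N = 0 /\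
  (x * y) (Z2_val x + Z2_val y).+1 != 0.
Proof.
move=> x0 y0; set k := Z2_val x; set l := Z2_val y.
have dv (z : Z2) N : z != 0 -> (Z2_val z <= N)%N -> (pow2 (Z2_val z) %| z N)%Z.
  by move=> z0 zN; rewrite dvd_digits// Z2_val_dvd.
split.
  apply/dvdz_mod0P; rewrite /pow2 exprD; apply: dvdz_mul.
    by apply: dv; rewrite // leq_addr.
  by apply: dv; rewrite // leq_addl.
apply/negP => /eqP/dvdz_mod0P.
set N := (k + l).+1.
have [kN lN] : (k < N)%N /\ (l < N)%N by rewrite !ltnS leq_addr leq_addl.
have /dvdzP[u xu] := dv x N x0 (ltnW kN).
have /dvdzP[w yw] := dv y N y0 (ltnW lN).
have : ~~ (pow2 k.+1 %| x N)%Z by rewrite dvd_digits// Z2_val_dvd// ltnn.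
have : ~~ (pow2 l.+1 %| y N)%Z by rewrite dvd_digits// Z2_val_dvd// ltnn.
rewrite xu yw -/k -/l [pow2 k.+1]exprS [pow2 l.+1]exprS.
rewrite !dvdz_mul2r; [|exact: pow2_neq0..].
rewrite mulrACA -[_ * pow2 l]exprD [pow2 N]exprS dvdz_mul2r ?pow2_neq0//.
by rewrite !dvdzE abszM Euclid_dvdM// => /negPf-> /negPf->.
Qed.

Fact Z2_integral (x y : Z2) : x * y = 0 -> (x == 0) || (y == 0).
Proof.
move=> xy; apply/negPn/negP; rewrite negb_or => /andP[x0 y0].
by have [_] := Z2_mul_val x0 y0; rewrite xy Z2_0E eqxx.
Qed.

HB.instance Definition _ := GRing.ComUnitRing_isIntegral.Build Z2 Z2_integral.

Lemma Z2_valM (x y : Z2) : x != 0 -> y != 0 ->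
  Z2_val (x * y) = (Z2_val x + Z2_val y)%N.
Proof.
move=> x0 y0; have [/eqP] := Z2_mul_val x0 y0.
have xy0 : x * y != 0 by rewrite mulf_neq0.
by rewrite !Z2_val_dvd// -ltnNge ltnS => h1 h2; apply/eqP; rewrite eqn_leq h1 h2.
Qed.

Lemma Z2_valD (x y : Z2) : x != 0 -> y != 0 -> x + y != 0 ->
  (minn (Z2_val x) (Z2_val y) <= Z2_val (x + y)%R)%N.
Proof.
move=> x0 y0 xy0; rewrite -Z2_val_dvd//; set m := minn _ _.
have /eqP xm : x m == 0 by rewrite Z2_val_dvd// geq_minl.
have /eqP ym : y m == 0 by rewrite Z2_val_dvd// geq_minr.
by rewrite /= xm ym addr0 mod0z.
Qed.

Definition Z2_abs (x : Z2) : rat := if x == 0 then 0 else 2 ^- Z2_val x.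

Lemma Z2_abs_ge0 x : 0 <= Z2_abs x.
Proof. by rewrite /Z2_abs; case: ifP => // _; rewrite invr_ge0 exprn_ge0. Qed.

Lemma Z2_abs_eq0 x : (Z2_abs x == 0) = (x == 0).
Proof.
rewrite /Z2_abs; case: ifP => //; rewrite ?eqxx// => _.
by rewrite invr_eq0 expf_eq0 andbF.
Qed.

Lemma Z2_absM x y : Z2_abs (x * y) = Z2_abs x * Z2_abs y.
Proof.
rewrite /Z2_abs mulf_eq0; have [_|x0] := eqVneq x 0; first by rewrite mul0r.
have [_|y0] := eqVneq y 0; first by rewrite mulr0.
by rewrite /= Z2_valM// exprD invfM.
Qed.

Lemma Z2_absD x y : Z2_abs (x + y) <= Num.max (Z2_abs x) (Z2_abs y).
Proof.
have [->|x0] := eqVneq x 0; first by rewrite add0r le_max lexx orbT.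
have [->|y0] := eqVneq y 0; first by rewrite addr0 le_max lexx.
have [->|xy0] := eqVneq (x + y) 0.
  by rewrite {1}/Z2_abs eqxx le_max Z2_abs_ge0.
have := Z2_valD x0 y0 xy0.
rewrite /Z2_abs (negPf x0) (negPf y0) (negPf xy0) geq_min le_max.
by rewrite !lef_pV2 ?qualifE/= ?exprn_gt0// !ler_eXn2l.
Qed.

Definition Q2 : Type := {fraction Z2}.
HB.instance Definition _ := GRing.Field.on Q2.

(* frac (repr x) is a chosen pair (numerator, denominator) representing x. *)
Definition padic_abs (x : Q2) : rat :=
  Z2_abs (frac (repr x)).1 / Z2_abs (frac (repr x)).2.

Local Notation "x %:F" := (@FracField.tofrac Z2 x).

Lemma Q2_numden (x : Q2) :
  x = (frac (repr x)).1%:F / (frac (repr x)).2%:F :> {fraction Z2}.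
Proof.
have d0 : (frac (repr x)).2%:F != 0 by rewrite tofrac_eq0 denom_ratioP.
apply: (canRL (mulfK d0)); rewrite -[X in X * _](@reprK _ {fraction Z2} x).
unlock FracField.tofrac; rewrite -[LHS]FracField.pi_mul; apply/eqmodP => /=.
rewrite FracField.equivfE /FracField.mulf !numden_Ratio ?oner_eq0//; last first.
- by rewrite mulr1 denom_ratioP.
- by rewrite mulr1 denom_ratioP.
by rewrite !mulr1 mulrC.
Qed.

Lemma padic_abs_frac (m n : Z2) : n != 0 ->
  padic_abs (m%:F / n%:F) = Z2_abs m / Z2_abs n.
Proof.
move=> n0; rewrite /padic_abs; set x : Q2 := m%:F / n%:F.
have := Q2_numden x; set p := (frac (repr x)).1; set q := (frac (repr x)).2.
have q0 : q != 0 by rewrite denom_ratioP.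
move/eqP; rewrite /x eqr_div ?tofrac_eq0// -!tofracM tofrac_eq => /eqP.
move/(congr1 Z2_abs); rewrite !Z2_absM => mq.
by apply/eqP; rewrite eqr_div ?Z2_abs_eq0//; apply/eqP.
Qed.

Lemma Q2_ex (x : Q2) : exists m n : Z2, n != 0 /\ x = m%:F / n%:F.
Proof.
exists (frac (repr x)).1, (frac (repr x)).2; split; first exact: denom_ratioP.
exact: Q2_numden.
Qed.

Lemma padic_abs_ge0 x : 0 <= padic_abs x.
Proof. by rewrite divr_ge0// Z2_abs_ge0. Qed.

Lemma padic_absM x y : padic_abs (x * y) = padic_abs x * padic_abs y.
Proof.
have [m [n [n0 ->]]] := Q2_ex x; have [p [q [q0 ->]]] := Q2_ex y.
rewrite [(_ / _ : Q2) * _]mulf_div -!tofracM !padic_abs_frac ?mulf_neq0//.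
by rewrite !Z2_absM mulf_div.
Qed.

Lemma padic_abs_eq0 x : (padic_abs x == 0) = (x == 0).
Proof.
have [m [n [n0 ->]]] := Q2_ex x; rewrite padic_abs_frac//.
by rewrite !mulf_eq0 !invr_eq0 !Z2_abs_eq0 !tofrac_eq0.
Qed.

Lemma padic_absD x y : padic_abs (x + y) <= Num.max (padic_abs x) (padic_abs y).
Proof.
have [m [n [n0 ->]]] := Q2_ex x; have [p [q [q0 ->]]] := Q2_ex y.
rewrite [_ + _]addf_div ?tofrac_eq0// -!tofracM -tofracD.
rewrite !padic_abs_frac ?mulf_neq0//.
have nq : 0 < Z2_abs (n * q).
  by rewrite lt_def Z2_abs_eq0 mulf_neq0//= Z2_abs_ge0.
rewrite ler_pdivrMr//.
have -> : Z2_abs m / Z2_abs n = Z2_abs (m * q) / Z2_abs (n * q).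
  by rewrite !Z2_absM -mulf_div divff ?mulr1// Z2_abs_eq0.
have -> : Z2_abs p / Z2_abs q = Z2_abs (p * n) / Z2_abs (n * q).
  by rewrite !Z2_absM [X in _ = _ / X]mulrC -mulf_div divff ?mulr1// Z2_abs_eq0.
rewrite maxr_pMl ?(ltW nq)// !mulfVK ?gt_eqF//; exact: Z2_absD.
Qed.

Lemma padic_absN x : padic_abs (- x) = padic_abs x.
Proof.
have /eqP : padic_abs (-1) ^+ 2 = 1.
  rewrite expr2 -padic_absM mulrNN mulr1 -[X in padic_abs X]divr1.
  rewrite -[X in X / _]tofrac1 -[X in _ / X]tofrac1 padic_abs_frac ?oner_eq0//.
  by rewrite divff// Z2_abs_eq0 oner_eq0.
rewrite sqrp_eq1 ?padic_abs_ge0// => /eqP N1.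
by rewrite -mulN1r padic_absM N1 mul1r.
Qed.

Definition Q2_dist (x y : Q2) : rat := padic_abs (x - y).

Fact Q2_dist_xx x : Q2_dist x x = 0.
Proof. by apply/eqP; rewrite /Q2_dist subrr padic_abs_eq0. Qed.
Fact Q2_dist_positivity x y : Q2_dist x y = 0 -> x = y.
Proof. by move/eqP; rewrite padic_abs_eq0 subr_eq0 => /eqP. Qed.
Fact Q2_dist_sym x y : Q2_dist x y = Q2_dist y x.
Proof. by rewrite /Q2_dist -padic_absN opprB. Qed.
Fact Q2_dist_triangle y x z : Q2_dist x z <= Q2_dist x y + Q2_dist y z.
Proof.
have -> : Q2_dist x z = padic_abs ((x - y) + (y - z)).
  by rewrite addrA subrK.
apply: le_trans (padic_absD _ _) _.
by rewrite ge_max lerDl lerDr !padic_abs_ge0.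
Qed.

HB.instance Definition _ := isMetric.Build rat Q2
  Q2_dist_xx Q2_dist_positivity Q2_dist_sym Q2_dist_triangle.

Definition P1 : Type := one_point_compactification Q2.
HB.instance Definition _ := Topological.on P1.
HB.instance Definition _ := Pointed.on P1.

Definition infty : P1 := None.
Definition fin (x : Q2) : P1 := Some x.

Definition mobius (a b c d : Q2) (z : P1) : P1 :=
  match z with
  | Some x => if c * x + d == 0 then infty
              else fin ((a * x + b) / (c * x + d))
  | None => if c == 0 then infty else fin (a / c)
  end.

Section dynamics.
Context {X : topologicalType}.
Implicit Types (phi : X -> X) (E : set X).

Definition subsystem phi E := compact E /\ phi @` E `<=` E.

Definition orbit phi (x : X) : set X := range (fun n : nat => iter n phi x).

Definition minimal_subsystem phi E :=
  subsystem phi E /\ forall x, E x -> E = closure (orbit phi x).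

Definition decomposed phi (M : nat) := exists E : 'I_M -> set X,
  [/\ forall i, E i !=set0 /\ minimal_subsystem phi (E i),
      trivIset [set: 'I_M] E
    & \bigcup_i E i = [set: X]].

End dynamics.

Definition topologically_conjugate {X Y : topologicalType}
    (E : set X) (phi : X -> X) (F : set Y) (psi : Y -> Y) :=
  exists (h : X -> Y) (k : Y -> X),
    [/\ h @` E `<=` F /\ k @` F `<=` E,
        {within E, continuous h} /\ {within F, continuous k},
        (forall x, E x -> k (h x) = x) /\ (forall y, F y -> h (k y) = y)
      & forall x, E x -> h (phi x) = psi (h x)].

(* Z/p_s is represented by the naturals below p_s, and the inverse limit is a
   subset of the product of countably many copies of the discrete space nat. *)
Definition odometer_space : topologicalType := prod_topology (fun _ : nat => nat).

Definition odometer (p : nat -> nat) : set odometer_space :=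
  [set x | forall s, (x s < p s)%N /\ x s = (x s.+1 %% p s)%N].

Definition adding_machine (p : nat -> nat) (x : odometer_space) :
  odometer_space := fun s => ((x s).+1 %% p s)%N.

Section valuations.
Context {R : realType} {K : fieldExtType Q2}.
Implicit Type absK : K -> R.

Definition is_extension_of_padic_abs absK :=
  [/\ forall x, 0 <= absK x /\ (absK x = 0 <-> x = 0),
      forall x y, absK (x * y) = absK x * absK y,
      forall x y, absK (x + y) <= Num.max (absK x) (absK y)
    & forall x : Q2, absK x%:A = ratr (padic_abs x)].

Definition is_uniformizer absK (pi : K) :=
  [/\ pi != 0, absK pi < 1 & forall x, absK x < 1 -> absK x <= absK pi].

(* e is the index of the value group of Q2 in the value group of K: r is a
   system of representatives of the quotient. *)
Definition is_ramification_index absK (e : nat) :=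
  exists r : 'I_e -> K, (forall i, r i != 0) /\
    forall x, x != 0 -> exists! i, exists2 q : Q2, q != 0 &
      absK x = absK (r i) * absK q%:A.

(* v2 and v_pi are only meaningful at nonzero arguments. *)
Definition v2 absK (x : K) : R := - (ln (absK x) / ln 2).

Definition v_pi absK (e : nat) (x : K) : R := e%:R * v2 absK x.

End valuations.

Section quadratic.
Variable K : fieldExtType Q2.

(* s is a square root of m and K = Q2(s). *)
Definition generating_sqrt (m : Q2) (s : K) :=
  s ^+ 2 = m%:A /\ <<1%VS; s>>%VS = fullv.

Definition is_Q2_sqrt (m : Q2) := exists s : K, generating_sqrt m s.

Definition lambda (a d : Q2) (s : K) : K :=
  ((a + d)%:A + s) / ((a + d)%:A - s).

End quadratic.

Definition disc (a b c d : Q2) : Q2 := (d - a) ^+ 2 + 4 * b * c.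

(* Main.v *)
Require Import Defs.
From HB Require Import structures.
From mathcomp Require Import all_boot all_order all_algebra all_field.
From mathcomp Require Import all_classical all_reals all_analysis.
From mathcomp Require Import ring lra zify.

(** Put [w = (2 c z + d - a) / mu] with [D = disc / mu ^ 2] of absolute value
    [1/2] and [s ^ 2 = D].  Sending [w] to the class of [w + s] identifies the
    projective line with [K^* / Q2^*], and the map becomes multiplication by
    [T + s], where [T = (a + d) / mu].  Since [s] is a uniformizer, every class has
    a unique representative [s ^ p * (1 + y * s)] with [p] in [{0, 1}] and [y]
    in the closed unit ball, and up to a scalar [T + s] is [s ^ f * (1 + u * s)],
    with [f = 0] if [|T| >= 1] and [f = 1] otherwise.  So the map is
    [(p, y) |-> (p + f, (y + u) / (1 + D u y))].  If [|u| = 2 ^ -k], the [n]-th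
    iterate of the second factor moves every [y] by exactly [|n u|], so modulo
    [2 ^ (k + s)] all orbits have length a power of [2] that doubles with [s]:
    this gives [2 ^ (k + 1)] minimal components, each of them an odometer.  The
    formula for [lambda] yields [|lambda -+ 1| = |s| / 2 * 2 ^ -k]. *)

Import Order.TTheory GRing.Theory Num.Theory.
Local Open Scope classical_set_scope.
Local Open Scope ring_scope.

Set Implicit Arguments.
Unset Strict Implicit.
Unset Printing Implicit Defensive.

(** * Systems of dyadic levels *)

(* [L s x] names the level-[s] clopen cell of [x]; the cells of level [s] inside
   one cell of level [0] are permuted cyclically with period [2 ^ s]. *)
Record dyadic_levels {X : topologicalType} (phi : X -> X) (L : nat -> X -> nat)
    : Prop := DyadicLevels {
  levels_open : forall s x, nbhs x [set y | L s y = L s x];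
  levels_base : forall x U, nbhs x U ->
    exists s, [set y | L s y = L s x] `<=` U;
  levels_refine : forall s x y, L s.+1 x = L s.+1 y -> L s x = L s y;
  levels_compat : forall s x y, L s x = L s y -> L s (phi x) = L s (phi y);
  levels_period : forall s n x, L s (iter n phi x) = L s x <-> (2 ^ s %| n)%N;
  levels_split : forall s x y, L s x = L s y ->
    L s.+1 x = L s.+1 y \/ L s.+1 (iter (2 ^ s) phi x) = L s.+1 y;
  levels_sep : forall x y, (forall s, L s x = L s y) -> x = y }.

Lemma levels_le {X : topologicalType} {phi : X -> X} {L : nat -> X -> nat}
    (HL : dyadic_levels phi L) s t x y :
  (s <= t)%N -> L t x = L t y -> L s x = L s y.
Proof.
move=> /subnK <-; elim: (t - s)%N => // k IH.
by rewrite addSn => /(levels_refine HL); exact: IH.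
Qed.

Lemma levels_invariant {X : topologicalType} {phi : X -> X} {L : nat -> X -> nat}
    (HL : dyadic_levels phi L) n x : L 0%N (iter n phi x) = L 0%N x.
Proof. by apply/(levels_period HL); rewrite expn0 dvd1n. Qed.

Lemma levels_iter_eq {X : topologicalType} {phi : X -> X} {L : nat -> X -> nat}
    (HL : dyadic_levels phi L) s m n x :
  L s (iter m phi x) = L s (iter n phi x) <-> m = n %[mod 2 ^ s].
Proof.
wlog mn : m n / (m <= n)%N.
  move=> H; case/orP: (leq_total m n) => [/H//|/H[H1 H2]].
  by split=> [/esym/H1/esym|/esym/H2/esym].
rewrite -(subnK mn) iterD; split.
  move=> /esym/(levels_period HL) /dvdnP[q ->].
  by rewrite modnMDl.
move=> /eqP; rewrite eq_sym -[X in _ == X %[mod _]]add0n eqn_modDr mod0n => h.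
by apply/esym/(levels_period HL).
Qed.

(** A time reaching the level-[s] cell of [y] is lengthened by [0] or [2 ^ s] to reach its
    level-[s.+1] cell. *)
Lemma levels_transitive {X : topologicalType} {phi : X -> X} {L : nat -> X -> nat}
    (HL : dyadic_levels phi L) s x y : L 0%N x = L 0%N y ->
  exists n, L s (iter n phi x) = L s y.
Proof.
move=> xy; elim: s => [|s [n IH]]; first by exists 0%N.
have [h|h] := levels_split HL IH; first by exists n.
by exists (2 ^ s + n)%N; rewrite iterD.
Qed.

Lemma level_open {X : topologicalType} {phi : X -> X} {L : nat -> X -> nat}
    (HL : dyadic_levels phi L) s (P : set nat) : open [set y | P (L s y)].
Proof.
rewrite openE => y Py; rewrite /interior /=.
by apply: filterS (levels_open HL s y) => z /= ->.
Qed.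

Lemma level_closed {X : topologicalType} {phi : X -> X} {L : nat -> X -> nat}
    (HL : dyadic_levels phi L) s i : closed [set y | L s y = i].
Proof. by rewrite -openC; exact: (level_open HL s (fun j => j <> i)). Qed.

(** Level-[0] cells are clopen and invariant, so they contain the closure; conversely the cells form
    a base, and the orbit meets every cell inside its level-[0] cell. *)
Lemma closure_orbit {X : topologicalType} {phi : X -> X} {L : nat -> X -> nat}
    (HL : dyadic_levels phi L) x :
  closure (Defs.orbit phi x) = [set y | L 0%N y = L 0%N x].
Proof.
apply/seteqP; split => [y clxy|y /= xy U /(levels_base HL)[s sU]].
  have [_ [[n _ <-]]] := clxy _ (levels_open HL 0%N y).
  by move=> /= <-; exact: (levels_invariant HL).
have [n nE] := levels_transitive HL s (esym xy).
by exists (iter n phi x); split; [exists n | exact: sU].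
Qed.

Lemma level0_minimal {X : topologicalType} {phi : X -> X} {L : nat -> X -> nat}
    (HL : dyadic_levels phi L) (cX : compact [set: X]) i :
  minimal_subsystem phi [set y | L 0%N y = i].
Proof.
split; [split|].
- by apply: subclosed_compact cX _ => //; exact: (level_closed HL).
- by move=> _ [y /= <- <-]; exact: (levels_invariant HL 1).
- by move=> x /= <-; rewrite (closure_orbit HL).
Qed.

Lemma levels_decomposed {X : topologicalType} {phi : X -> X} {L : nat -> X -> nat}
    (HL : dyadic_levels phi L) (cX : compact [set: X]) M
    (HM : forall i, (i < M)%N <-> exists x, L 0%N x = i) : decomposed phi M.
Proof.
exists (fun i : 'I_M => [set y | L 0%N y = i]); split.
- move=> i; split; last exact: level0_minimal.
  by have [x xi] := (HM i).1 (ltn_ord i); exists x.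
- by move=> i j _ _ [y [/= yi yj]]; apply: val_inj; rewrite /= -yi -yj.
- apply/seteqP; split => // y _.
  have yM : (L 0%N y < M)%N by apply/HM; exists y.
  by exists (Ordinal yM).
Qed.

(** The cells of the [u s] are nested and closed, so any cluster point of [u], which exists by
    compactness, lies in all of them. *)
Lemma levels_limit {X : topologicalType} {phi : X -> X} {L : nat -> X -> nat}
    (HL : dyadic_levels phi L) (cX : compact [set: X]) (u : nat -> X) :
  (forall s, L s (u s) = L s (u s.+1)) -> exists y, forall s, L s y = L s (u s).
Proof.
move=> uS.
have uL s t : (s <= t)%N -> L s (u s) = L s (u t).
  move=> /subnK <-; elim: (t - s)%N => // k IH; rewrite IH addSn.
  by apply: (levels_le HL) (uS _); rewrite leq_addl.
have [y [_ cly]] : [set: X] `&` cluster (u @ \oo) !=set0.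
  by apply: cX; exact: filterT.
exists y => s.
have FA : (u @ \oo) [set z | L s z = L s (u s)].
  by exists s => // t /= st; rewrite -uL.
by have [z [/= zu zy]] := cly _ _ FA (levels_open HL s y); rewrite -zy.
Qed.

(** With [x] fixed in [E], a point [y] goes to the times, modulo [2 ^ s], at which the orbit of [x]
    enters the level-[s] cell of [y]. The inverse map comes from [levels_limit]. *)
Lemma levels_adding_machine {X : topologicalType} {phi : X -> X}
    {L : nat -> X -> nat} (HL : dyadic_levels phi L) (cX : compact [set: X])
    (E : set X) : E !=set0 -> minimal_subsystem phi E ->
  topologically_conjugate E phi
    (odometer (fun s => (2 ^ s)%N)) (adding_machine (fun s => (2 ^ s)%N)).
Proof.
move=> [x Ex] [_ /(_ _ Ex) EE]; rewrite (closure_orbit HL) in EE.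
(* The condition [E y] sits under the quantifier so that the chosen time is total in [y], with a
   junk value outside [E]. *)
have hP y s : exists n, (E y -> L s (iter n phi x) = L s y).
  have [/=Ey|] := pselect (E y); last by exists 0%N.
  rewrite EE in Ey; have [n nE] := levels_transitive HL s (esym Ey).
  by exists n.
pose h (y : X) : odometer_space := fun s => (projT1 (cid (hP y s)) %% 2 ^ s)%N.
have hE y s : E y -> L s (iter (h y s) phi x) = L s y.
  rewrite /h; case: cid => n /= nE Ey; rewrite -(nE Ey).
  by apply/(levels_iter_eq HL); rewrite modn_mod.
(* Uniqueness of the time modulo [2 ^ s]: coherence, continuity of [h] and equivariance all reduce
   to it. *)
have h_uniq y s n : E y -> L s (iter n phi x) = L s y -> h y s = (n %% 2 ^ s)%N.
  move=> Ey; rewrite -(hE y s Ey) => /(levels_iter_eq HL) ->.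
  by rewrite /h modn_mod.
have h_lt y s : (h y s < 2 ^ s)%N by rewrite ltn_mod expn_gt0.
pose O := odometer (fun s => (2 ^ s)%N).
have kP (a : odometer_space) :
    exists y, O a -> E y /\ forall s, L s y = L s (iter (a s) phi x).
  have [Oa|] := pselect (O a); last by exists x.
  have [|y yP] := @levels_limit X phi L HL cX (fun s => iter (a s) phi x).
    move=> s; apply/(levels_iter_eq HL).
    by have [_ {1}->] := Oa s; rewrite modn_mod.
  exists y => _; split=> //; rewrite EE /= yP.
  exact: (levels_invariant HL).
pose k a := projT1 (cid (kP a)).
have kE a : O a -> E (k a) /\ forall s, L s (k a) = L s (iter (a s) phi x).
  by rewrite /k; case: cid.
have hO y : E y -> O (h y).
  move=> Ey s; split; first exact: h_lt.
  apply: h_uniq => //; apply: (levels_refine HL); exact: hE.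
exists h, k; split.
- split=> [_ [y Ey <-]|_ [a Oa <-]]; first exact: hO.
  by have [] := kE a Oa.
- split; apply/subspace_continuousP.
    move=> y Ey; apply/pointwise_cvgP => s U hU.
    have Uh : U (h y s) by exact: nbhs_singleton hU.
    apply: filterS (levels_open HL s y) => z /= zy Ez.
    suff zs : h y s = h z s by rewrite -[from_subspace _ _ _ _]zs.
    rewrite (h_uniq z s (h y s) Ez) ?modn_small//.
    by rewrite zy; exact: hE.
  move=> a Oa U /(levels_base HL)[s sU].
  have ca : nbhs a [set b : odometer_space | b s = a s].
    exact: (@proj_continuous _ (fun _ : nat => nat) s a [set a s]).
  apply: filterS ca => b /= ba Ob; apply: sU => /=.
  by have [_ ->] := kE _ Ob; have [_ ->] := kE _ Oa; rewrite ba.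
- split=> [y Ey|a Oa].
    apply: (levels_sep HL) => s.
    by have [_ ->] := kE _ (hO _ Ey); exact: hE.
  have [Ek kL] := kE a Oa.
  apply/funext => s; have [_ _] := Oa s.
  rewrite (h_uniq _ _ (a s) Ek) ?kL//.
  by rewrite modn_small//; have [] := Oa s.
- move=> y Ey; have Ephi : E (phi y).
    by move: Ey; rewrite EE /= => <-; exact: (levels_invariant HL 1).
  apply/funext => s; rewrite (h_uniq _ _ (h y s).+1 Ephi) //=.
  by apply: (levels_compat HL); exact: hE.
Qed.

(** * The 2-adic absolute value *)

Lemma padic_abs0 : padic_abs 0 = 0.
Proof. by apply/eqP; rewrite padic_abs_eq0. Qed.

Lemma padic_abs_gt0 x : (0 < padic_abs x) = (x != 0).
Proof. by rewrite lt_def padic_abs_ge0 padic_abs_eq0 andbT. Qed.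

Lemma padic_abs1 : padic_abs 1 = 1.
Proof.
have := padic_absM 1 1; rewrite mulr1 -[LHS]mul1r => /mulIf -> //.
by rewrite padic_abs_eq0 oner_eq0.
Qed.

Lemma padic_absV x : padic_abs x^-1 = (padic_abs x)^-1.
Proof.
have [->|x0] := eqVneq x 0; first by rewrite invr0 padic_abs0 invr0.
have a0 : padic_abs x != 0 by rewrite padic_abs_eq0.
by apply: (mulIf a0); rewrite -padic_absM !mulVf// padic_abs1.
Qed.

Lemma padic_abs_div x y : padic_abs (x / y) = padic_abs x / padic_abs y.
Proof. by rewrite padic_absM padic_absV. Qed.

Lemma padic_absX x n : padic_abs (x ^+ n) = padic_abs x ^+ n.
Proof.
elim: n => [|n IH]; first by rewrite !expr0 padic_abs1.
by rewrite !exprS padic_absM IH.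
Qed.

Lemma padic_absB x y : padic_abs (x - y) = padic_abs (y - x).
Proof. by rewrite -padic_absN opprB. Qed.

Lemma padic_abs_le_add r x y :
  padic_abs x <= r -> padic_abs y <= r -> padic_abs (x + y) <= r.
Proof. by move=> xr yr; apply: le_trans (padic_absD _ _) _; rewrite ge_max xr. Qed.

Lemma padic_abs_le_sub r x y :
  padic_abs x <= r -> padic_abs y <= r -> padic_abs (x - y) <= r.
Proof. by move=> xr yr; apply: padic_abs_le_add; rewrite ?padic_absN. Qed.

Lemma padic_abs_lt_add r x y :
  padic_abs x < r -> padic_abs y < r -> padic_abs (x + y) < r.
Proof.
by move=> xr yr; apply: le_lt_trans (padic_absD _ _) _; rewrite gt_max xr.
Qed.

(** If [x + y] were smaller than [x], then [x = (x + y) - y] would be smaller than itself. *)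
Lemma padic_absD_dom x y :
  padic_abs y < padic_abs x -> padic_abs (x + y) = padic_abs x.
Proof.
move=> yx; apply/eqP; rewrite eq_le padic_abs_le_add ?(ltW yx)//=.
rewrite leNgt; apply/negP => h.
have := padic_abs_lt_add h (_ : padic_abs (- y) < padic_abs x).
by rewrite padic_absN addrK ltxx => /(_ yx).
Qed.

Local Notation "x %:F" := (@FracField.tofrac Z2 x).

Lemma padic_abs_tofrac (z : Z2) : padic_abs z%:F = Z2_abs z.
Proof.
rewrite -[X in padic_abs X]divr1 -[X in _ / X]tofrac1 padic_abs_frac ?oner_eq0//.
suff -> : Z2_abs 1 = 1 by rewrite divr1.
have := padic_abs1; rewrite -[X in padic_abs X]divr1 -[X in _ / X]tofrac1.
rewrite padic_abs_frac ?oner_eq0// => _.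
have h : Z2_abs 1 != 0 by rewrite Z2_abs_eq0 oner_eq0.
by apply: (mulIf h); rewrite mul1r -Z2_absM mul1r.
Qed.

Lemma Z2_abs_le (z : Z2) n : (Z2_abs z <= 2 ^- n) = (z n == 0).
Proof.
have [->|z0] := eqVneq z 0.
  by rewrite Z2_0E eqxx /Z2_abs eqxx invr_ge0 exprn_ge0.
rewrite Z2_val_dvd// /Z2_abs (negPf z0).
by rewrite lef_pV2 ?qualifE/= ?exprn_gt0// ler_eXn2l.
Qed.

Lemma Z2_digit_lt (z : Z2) n : 0 <= z n < pow2 n.
Proof.
by rewrite -(Z2_red z n) modz_ge0 ?pow2_neq0//= ltz_pmod// exprn_gt0.
Qed.

(** The residue modulo [2 ^ (v + 1)] is [q * 2 ^ v] with [0 < q < 2]: the residue field has a single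
    nonzero element. *)
Lemma Z2_unit_digit (z : Z2) : z != 0 -> z (Z2_val z).+1 = pow2 (Z2_val z).
Proof.
move=> /Z2_valP[zv]; set v := Z2_val z in zv *.
have /andP[] := Z2_digit_lt z v.+1.
move: zv; rewrite (digitsP z) => /dvdz_mod0P/dvdzP[q ->].
have p0 : 0 < pow2 v by rewrite exprn_gt0.
rewrite pmulr_lge0// [pow2 v.+1]exprS ltr_pM2r// mulf_eq0.
rewrite (negPf (pow2_neq0 v)) orbF => q0 q2 qn.
suff -> : q = 1 by rewrite mul1r.
by move: q q0 q2 qn => [[|[|]]|].
Qed.

(** Numerator and denominator share a valuation [v], so both are [2 ^ v] modulo [2 ^ (v + 1)] and
    their difference gains a factor 2. *)
Lemma padic_abs_unit_sub1 w : padic_abs w = 1 -> padic_abs (w - 1) <= 2^-1.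
Proof.
have [m [n [n0 ->]]] := Q2_ex w; rewrite padic_abs_frac// => h.
have zn : Z2_abs n != 0 by rewrite Z2_abs_eq0.
have mn : Z2_abs m = Z2_abs n by rewrite -[LHS](divfK zn) h mul1r.
have m0 : m != 0 by rewrite -Z2_abs_eq0 mn.
have -> : (m%:F / n%:F : Q2) - 1 = (m - n)%:F / n%:F.
  rewrite tofracB mulrBl divff ?tofrac_eq0//.
rewrite padic_abs_frac// ler_pdivrMr ?lt_def ?zn ?Z2_abs_ge0//.
have vmn : Z2_val m = Z2_val n.
  move: mn; rewrite /Z2_abs (negPf m0) (negPf n0) => /invr_inj.
  by apply: ieexprIn.
rewrite {2}/Z2_abs (negPf n0) -invfM -exprS Z2_abs_le.
have := Z2_unit_digit m0; have := Z2_unit_digit n0; rewrite vmn /= => -> ->.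
by rewrite modzDmr subrr mod0z.
Qed.

Lemma padic_abs2 : padic_abs 2 = 2^-1.
Proof.
have -> : (2 : Q2) = (2 : Z2)%:F by rewrite tofracD tofrac1.
rewrite padic_abs_tofrac; apply/eqP; rewrite eq_le.
have -> : Z2_abs 2 <= 2^-1 = (Z2_abs 2 <= 2 ^- 1) by [].
rewrite Z2_abs_le /=.
have t0 : (2 : Z2) != 0 by apply/eqP => /(congr1 (fun z : Z2 => z 2%N)).
rewrite /Z2_abs (negPf t0) -[X in X <= _]/(2 ^- 1).
rewrite lef_pV2 ?qualifE/= ?exprn_gt0// ler_eXn2l//.
by rewrite leqNgt -Z2_val_dvd.
Qed.

Lemma padic_abs_pow2 n : padic_abs (2 ^+ n) = 2 ^- n.
Proof. by rewrite padic_absX padic_abs2 exprVn. Qed.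

Lemma Q2_2neq0 : (2 : Q2) != 0.
Proof. by rewrite -padic_abs_gt0 padic_abs2. Qed.

Lemma padic_abs_ex x : x != 0 -> exists k : int, padic_abs x = 2 ^ k.
Proof.
have [m [n [n0 ->]]] := Q2_ex x; rewrite padic_abs_frac// => mn0.
have m0 : m != 0 by apply: contraNneq mn0 => ->; rewrite tofrac0 mul0r.
rewrite /Z2_abs (negPf m0) (negPf n0) invrK.
exists ((Z2_val n)%:Z - (Z2_val m)%:Z).
by rewrite expfzDr// -exprnP -exprnN mulrC.
Qed.

Lemma padic_abs_gap x y :
  padic_abs x < padic_abs y -> padic_abs x <= padic_abs y / 2.
Proof.
have [->|x0] := eqVneq x 0; first by rewrite padic_abs0 => /ltW h; rewrite divr_ge0.
have [->|y0] := eqVneq y 0; first by rewrite padic_abs0 ltNge padic_abs_ge0.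
have [i ->] := padic_abs_ex x0; have [j ->] := padic_abs_ex y0.
have -> : 2 ^ j / 2 = 2 ^ (j - 1) :> rat by rewrite expfzDr// exprN1.
by rewrite ltr_eXz2l// ler_eXz2l// lerBrDr lezD1.
Qed.

Lemma padic_abs_sub_half x y :
  padic_abs x = padic_abs y -> padic_abs (x - y) <= padic_abs y / 2.
Proof.
have [->|y0] := eqVneq y 0; first by rewrite subr0 => ->; rewrite padic_abs0 mul0r.
move=> xy; have : padic_abs (x / y - 1) <= 2^-1.
  by apply: padic_abs_unit_sub1; rewrite padic_abs_div xy divff// padic_abs_eq0.
by rewrite -[X in _ - X](divff y0) -mulrBl padic_abs_div ler_pdivrMr ?padic_abs_gt0// mulrC.
Qed.

(** Either [x] is smaller than [y], or both have the same leading binary digit, which cancels in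
    [x + y]. This dichotomy produces binary expansions and the splitting of cells in two. *)
Lemma padic_abs_le_or_addr x y n : padic_abs x <= 2 ^- n -> padic_abs y = 2 ^- n ->
  padic_abs x <= 2 ^- n.+1 \/ padic_abs (x + y) <= 2 ^- n.+1.
Proof.
move=> xn yn; rewrite exprSr invfM.
move: xn; rewrite le_eqVlt => /orP[/eqP xn|xn]; last first.
  by left; rewrite -yn; apply: padic_abs_gap; rewrite yn.
by right; have := @padic_abs_sub_half x (- y); rewrite padic_absN yn opprK; apply.
Qed.

Lemma padic_abs_nat_le1 m : padic_abs m%:R <= 1.
Proof.
elim: m => [|m IH]; first by rewrite padic_abs0.
by rewrite -natr1; apply: padic_abs_le_add; rewrite ?padic_abs1.
Qed.

Lemma padic_abs_nat n m : (padic_abs m%:R <= 2 ^- n) = (2 ^ n %| m)%N.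
Proof.
elim: n m => [|n IH] m; first by rewrite invr1 padic_abs_nat_le1 dvd1n.
have half x : padic_abs (2 * x) <= 2 ^- n.+1 = (padic_abs x <= 2 ^- n).
  by rewrite padic_absM padic_abs2 exprS invfM ler_pM2l// invr_gt0.
have [mo|me] := boolP (odd m).
  have -> : (2 ^ n.+1 %| m)%N = false.
    apply/negP => h; have : (2 %| m)%N by apply: dvdn_trans h; rewrite expnS dvdn_mulr.
    by rewrite dvdn2 mo.
  have -> : m%:R = 1 + 2 * m./2%:R :> Q2.
    by rewrite -{1}[m]odd_double_half mo natrD -mul2n natrM.
  rewrite padic_absD_dom padic_abs1.
    by apply/negbTE; rewrite -ltNge invf_lt1 ?exprn_gt0// exprn_egt1.
  apply: le_lt_trans (_ : 2^-1 < 1) => //.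
  rewrite padic_absM padic_abs2 ler_piMr// padic_abs_nat_le1//.
have -> : m = (2 * m./2)%N by rewrite -{1}[m]odd_double_half (negPf me) mul2n.
by rewrite natrM half IH expnS dvdn_pmul2l.
Qed.

Lemma padic_abs_nat_sub n i j :
  (padic_abs (i%:R - j%:R) <= 2 ^- n) = (i == j %[mod 2 ^ n])%N.
Proof.
wlog ij : i j / (j <= i)%N.
  by move=> H; case/orP: (leq_total i j) => /H//; rewrite padic_absB eq_sym.
by rewrite -natrB// padic_abs_nat -eqn_mod_dvd.
Qed.

Lemma padic_residue n x : padic_abs x <= 1 ->
  exists2 r, (r < 2 ^ n)%N & padic_abs (x - r%:R) <= 2 ^- n.
Proof.
move=> x1; elim: n => [|n [r rn IH]].
  by exists 0%N => //; rewrite subr0 invr1.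
have p2 : padic_abs (- 2 ^+ n) = 2 ^- n by rewrite padic_absN padic_abs_pow2.
have [h|h] := padic_abs_le_or_addr IH p2.
- by exists r => //; rewrite (ltn_trans rn)// ltn_exp2l.
- exists (r + 2 ^ n)%N; last by rewrite natrD opprD addrA natrX.
  by rewrite expnS mul2n -addnn ltn_add2r.
Qed.

(* Junk value [0] outside the closed unit ball. *)
Definition residue (n : nat) (x : Q2) : nat :=
  if pselect (padic_abs x <= 1) is left h
  then s2val (cid2 (padic_residue n h)) else 0%N.

Lemma residue_lt n x : (residue n x < 2 ^ n)%N.
Proof.
rewrite /residue; case: pselect => [h|_]; last by rewrite expn_gt0.
exact: s2valP (cid2 (padic_residue n h)).
Qed.

Lemma residueP n x : padic_abs x <= 1 ->
  padic_abs (x - (residue n x)%:R) <= 2 ^- n.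
Proof.
move=> x1; rewrite /residue; case: pselect => [h|//].
exact: s2valP' (cid2 (padic_residue n h)).
Qed.

Lemma residue_nat n i : residue n i%:R = (i %% 2 ^ n)%N.
Proof.
have := residueP n (padic_abs_nat_le1 i); rewrite padic_abs_nat_sub => /eqP ->.
by rewrite modn_small// residue_lt.
Qed.

Lemma residue_eq n x y : padic_abs x <= 1 -> padic_abs y <= 1 ->
  residue n x = residue n y <-> padic_abs (x - y) <= 2 ^- n.
Proof.
move=> /(residueP n) xr /(residueP n) yr; split => [xy|xy].
  have := padic_abs_le_sub xr yr; rewrite xy opprB addrA subrK; exact.
rewrite -(modn_small (residue_lt n x)) -(modn_small (residue_lt n y)).
apply/eqP; rewrite -padic_abs_nat_sub.
have := padic_abs_le_add (padic_abs_le_sub xy xr) yr.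
by have -> : x - y - (x - (residue n x)%:R) + (y - (residue n y)%:R) =
  (residue n x)%:R - (residue n y)%:R by ring.
Qed.

(** * Topology of the projective line *)

Lemma exists_pow2_lt (e : rat) : 0 < e -> exists n, 2 ^- n < e.
Proof.
move=> e0; exists (Num.bound e^-1); rewrite -[X in _ < X]invrK ltf_pV2 ?qualifE/=
  ?invr_gt0 ?exprn_gt0//.
apply: lt_trans (archi_boundP _) _; first by rewrite invr_ge0 ltW.
by rewrite -natrX ltr_nat ltn_expl.
Qed.

Lemma Q2_ballE (x y : Q2) (e : rat) : ball x e y = (padic_abs (y - x) < e) :> Prop.
Proof. by rewrite ballEmdist /= padic_absB. Qed.

Section BallCompact.
Context (c : Q2) (c0 : c != 0) (F : set_system Q2) (FU : UltraFilter F)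
  (FB : F [set x | padic_abs x <= padic_abs c]).

Let near n (r : nat) := F [set x | padic_abs (x / c - r%:R) <= 2 ^- n].

(** Each class modulo [2 ^ n] splits into two classes modulo [2 ^ n.+1], and an ultrafilter selects
    one of them. *)
Lemma ultra_residue n : exists r, near n r.
Proof.
elim: n => [|n [r nr]].
  exists 0%N; apply: filterS FB => x /= xc.
  by rewrite subr0 expr0 invr1 padic_abs_div ler_pdivrMr ?mul1r ?padic_abs_gt0.
have [h|h] := in_ultra_setVsetC [set x | padic_abs (x / c - r%:R) <= 2 ^- n.+1] FU.
  by exists r.
exists (r + 2 ^ n)%N; apply: filterS (filterI nr h) => x /= [xn xn1].
have p2 : padic_abs (- 2 ^+ n) = 2 ^- n by rewrite padic_absN padic_abs_pow2.
have [//|] := padic_abs_le_or_addr xn p2.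
by rewrite natrD opprD addrA natrX.
Qed.

Lemma near_coherent n r r' : near n r -> near n r' -> r = r' %[mod 2 ^ n].
Proof.
move=> nr nr'; have [x [/= h h']] := filter_ex (filterI nr nr').
apply/eqP; rewrite -padic_abs_nat_sub.
have -> : r%:R - r'%:R = (x / c - r'%:R) - (x / c - r%:R) by ring.
exact: padic_abs_le_sub.
Qed.

Lemma near_S n r : near n.+1 r -> near n r.
Proof.
apply: filterS => x /= h; apply: le_trans h _.
by rewrite lef_pV2 ?qualifE/= ?exprn_gt0// ler_eXn2l.
Qed.

Let lim_digit n : int := Posz (projT1 (cid (ultra_residue n))).

Lemma lim_digitP n : (lim_digit n = lim_digit n.+1 %[mod pow2 n])%Z.
Proof.
rewrite /lim_digit; case: cid => r hr; case: cid => r' /near_S hr' /=.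
rewrite /pow2 -natrX natz !modz_nat; congr Posz; exact: near_coherent hr hr'.
Qed.

(** The residues selected by the ultrafilter are coherent, hence define a 2-adic integer [z]; the
    limit is [c * z]. *)
Lemma ultra_cvg : exists l : Q2, F --> l.
Proof.
pose z := Z2_of lim_digitP; pose l : Q2 := FracField.tofrac z.
have lr n r : near n r -> padic_abs (l - r%:R) <= 2 ^- n.
  move=> nr; have -> : l - r%:R = FracField.tofrac (z - r%:R).
    by rewrite tofracB; congr (_ - _); elim: r {nr} => [|r IH];
      rewrite ?tofrac0// -!natr1 tofracD tofrac1 IH.
  rewrite padic_abs_tofrac Z2_abs_le.
  have rE : (r%:R : Z2) n = (r%:Z %% pow2 n)%Z.
    elim: r {nr} => [|r IH]; first by rewrite Z2_0E mod0z.
    by rewrite -natr1 /= IH modzDml modzDmr -addn1 PoszD.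
  rewrite /= rE /lim_digit; case: cid => r' /= /(near_coherent nr) rr'.
  have -> : (r'%:Z %% pow2 n)%Z = (r%:Z %% pow2 n)%Z.
    by rewrite /pow2 -natrX natz !modz_nat rr'.
  by rewrite modzDmr subrr mod0z.
exists (c * l) => U /nbhs_ballP[e /= e0 eU].
have [n ne] : exists n, padic_abs c * 2 ^- n < e.
  have ac : 0 < padic_abs c by rewrite padic_abs_gt0.
  have [n nP] := exists_pow2_lt (divr_gt0 e0 ac).
  by exists n; rewrite mulrC -ltr_pdivlMr.
have [r nr] := ultra_residue n; have lnr := lr n r nr.
apply: filterS nr => x /= xr; apply: eU; rewrite Q2_ballE padic_absB.
have -> : c * l - x = c * ((l - r%:R) - (x / c - r%:R)).
  by rewrite opprB addrA subrK mulrBr mulrCA divff// mulr1.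
rewrite padic_absM; apply: le_lt_trans ne.
apply: ler_wpM2l; first exact: padic_abs_ge0.
by apply: padic_abs_le_sub xr; exact: lnr.
Qed.

End BallCompact.

Lemma ball_closed (r : rat) : 0 <= r -> closed [set x : Q2 | padic_abs x <= r].
Proof.
move=> r0; rewrite -openC openE => x /= /negP; rewrite -ltNge => xr.
apply/nbhs_ballP; exists (padic_abs x); first exact: le_lt_trans r0 xr.
move=> y; rewrite Q2_ballE => xy; apply/negP; rewrite -ltNge.
have -> : y = x + (y - x) by ring.
by rewrite padic_absD_dom.
Qed.

Lemma ball_compact (c : Q2) : c != 0 ->
  compact [set x : Q2 | padic_abs x <= padic_abs c].
Proof.
move=> c0; rewrite compact_ultra => F FU FB.
have [l Fl] := ultra_cvg c0 FU FB; exists l; split => //.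
apply: ball_closed; first exact: padic_abs_ge0.
by move=> B /Fl/(filterI FB)/filter_ex.
Qed.

Lemma exists_pow2_gt (e : rat) : exists n, forall m, (n <= m)%N -> e < 2 ^+ m.
Proof.
exists (Num.bound `|e|) => m nm; apply: le_lt_trans (ler_norm e) _.
apply: lt_le_trans (archi_boundP (normr_ge0 e)) _.
by rewrite -natrX ler_nat (leq_trans nm)// ltnW// ltn_expl.
Qed.

(** Otherwise points [u n] of absolute value above [2 ^+ n] would cluster at some [p], whereas the
    points at distance less than 1 from [p] are bounded. *)
Lemma compact_bounded (C : set Q2) : compact C ->
  exists N : nat, forall x, C x -> padic_abs x <= 2 ^+ N.
Proof.
move=> cC; apply: contrapT => H.
have uP n : exists x, C x /\ 2 ^+ n < padic_abs x.
  apply: contrapT => nx; apply: H; exists n => x Cx.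
  by rewrite leNgt; apply/negP => h; apply: nx; exists x.
pose u n := projT1 (cid (uP n)).
have [Cu uN] : (forall n, C (u n)) /\ (forall n, 2 ^+ n < padic_abs (u n)).
  by split=> n; rewrite /u; case: cid => x [Cx xn].
have [p [_ clp]] : C `&` cluster (u @ \oo) !=set0.
  by apply: cC; exists 0%N => // n _; exact: Cu.
have [N NP] := exists_pow2_gt (padic_abs p).
have FA : (u @ \oo) [set x | 2 ^+ N < padic_abs x].
  exists N => // n /= Nn; apply: le_lt_trans (uN n).
  by rewrite ler_eXn2l.
have [x [/= Nx]] := clp _ _ FA (nbhsx_ballx p 1 ltr01).
rewrite Q2_ballE => xp; move: Nx; rewrite ltNge => /negP; apply.
have -> : x = (x - p) + p by ring.
apply: padic_abs_le_add; last exact/ltW/NP.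
by apply: le_trans (ltW xp) _; rewrite exprn_ege1.
Qed.

Lemma nbhs_fin (x : Q2) (U : set P1) : nbhs (fin x) U <->
  exists2 e : rat, 0 < e & forall y, padic_abs (y - x) < e -> U (fin y).
Proof.
split.
  move=> /nbhs_ballP[e e0 eU]; exists e => // y yx; apply: (eU y).
  by rewrite Q2_ballE.
move=> [e e0 eU]; apply/nbhs_ballP; exists e => // y.
by rewrite Q2_ballE; exact: eU.
Qed.

Lemma nbhs_infty (U : set P1) : nbhs infty U <->
  exists2 N : nat, U infty & forall y, 2 ^+ N < padic_abs y -> U (fin y).
Proof.
split.
  move=> [C [cC clC] CU]; have [N NC] := compact_bounded cC.
  exists N; first by apply: CU; right.
  move=> y Ny; apply: CU; left; exists y => // Cy.
  by move: Ny; rewrite ltNge NC.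
(* This is the closed ball of radius [2 ^+ N], written as the absolute value of [2 ^- N] to fit
   [ball_compact]. *)
move=> [N Uoo NU]; exists [set x | padic_abs x <= padic_abs (2 ^- N)].
  split; last exact: (ball_closed (padic_abs_ge0 _)).
  by apply: ball_compact; rewrite invr_neq0// expf_neq0// Q2_2neq0.
move=> _ [[y /= /negP ny <-]|-> //]; apply: NU.
by rewrite ltNge -[2 ^+ N]invrK -padic_abs_pow2 -padic_absV.
Qed.

(** * The chart of the projective line *)

(** Homogeneous coordinates; the meaningless pair [(0, 0)] is sent to [infty]. *)
Definition proj_pt (X Y : Q2) : P1 := if Y == 0 then infty else fin (X / Y).

Lemma proj_pt_scale k X Y : k != 0 -> proj_pt (k * X) (k * Y) = proj_pt X Y.
Proof.
move=> k0; rewrite /proj_pt mulf_eq0 (negPf k0) /=; case: ifP => // _.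
by rewrite -mulf_div divff// mul1r.
Qed.

Lemma mobius_proj_pt a b c d X Y : (X != 0) || (Y != 0) ->
  mobius a b c d (proj_pt X Y) = proj_pt (a * X + b * Y) (c * X + d * Y).
Proof.
rewrite /proj_pt; have [->|Y0 _] := eqVneq Y 0.
  rewrite orbF => X0 /=; rewrite !mulr0 !addr0 mulf_eq0 (negPf X0) orbF.
  by rewrite -mulf_div divff// mulr1.
have E (p q : Q2) : p * (X / Y) + q = (p * X + q * Y) / Y.
  by rewrite mulrDl mulfK// mulrA.
rewrite /mobius /fin !E mulf_eq0 invr_eq0 (negPf Y0) orbF; case: ifP => // _.
by rewrite invfM invrK mulrACA mulVf// mulr1.
Qed.

(* With [s ^+ 2 = D], the point [w] of the projective line is the class of
   [w + s]; the chart sends it to the pair [(p, y)] such that this class is also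
   that of [s ^+ p * (1 + y * s)], and [w = al * z + be]. *)
Definition encode (al be D : Q2) (x : P1) : bool * Q2 :=
  match x with
  | Some z => let w := al * z + be in
    if 1 <= padic_abs w then (false, w^-1) else (true, w / D)
  | None => (false, 0)
  end.

(** Since [s * (1 + y * s) = D * y + s], the value [p = 1] means [w = D * y], while [p = 0] means
    [w = 1 / y]. Homogeneous coordinates of [(w - be) / al] include the case [y = 0], the point at
    infinity. *)
Definition decode (al be D : Q2) (c : bool * Q2) : P1 :=
  if c.1 then proj_pt (c.2 * D - be) al else proj_pt (1 - be * c.2) (al * c.2).

Section Chart.
Context (al be D : Q2) (al0 : al != 0) (hD : padic_abs D = 2^-1).
Local Notation enc := (encode al be D).
Local Notation dec := (decode al be D).

Lemma padic_abs_half_neq0 : D != 0.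
Proof. by rewrite -padic_abs_gt0 hD. Qed.

(** Absolute values are powers of 2, so [padic_abs w < 1] forces
    [padic_abs w <= 2^-1 = padic_abs D]. *)
Lemma encode_le1 x : padic_abs (enc x).2 <= 1.
Proof.
case: x => [z|] /=; last by rewrite padic_abs0.
case: ifPn => [w1|]; first by rewrite padic_absV invf_le1// (lt_le_trans _ w1).
rewrite -ltNge => w1 /=; rewrite padic_abs_div hD invrK.
by rewrite -ler_pdivlMr// -[X in X / 2]padic_abs1 padic_abs_gap// padic_abs1.
Qed.

Lemma encodeK x : dec (enc x) = x.
Proof.
case: x => [z|] /=; rewrite /decode; last by rewrite /= !mulr0 /proj_pt eqxx.
set w := al * z + be; have zE : (w - be) / al = z.
  by rewrite /w addrK mulrC mulKf.
case: (leP 1 (padic_abs w)) => [w1|_] /=.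
  have w0 : w != 0 by rewrite -padic_abs_gt0 (lt_le_trans _ w1).
  rewrite -(proj_pt_scale _ _ w0) mulrBr mulr1 mulrCA mulfV// mulr1.
  by rewrite mulrCA mulfV// mulr1 /proj_pt (negPf al0) zE.
by rewrite divfK ?padic_abs_half_neq0// /proj_pt (negPf al0) zE.
Qed.

Lemma decodeK c : padic_abs c.2 <= 1 -> enc (dec c) = c.
Proof.
have alz w : al * ((w - be) / al) + be = w.
  by rewrite mulrC divfK// subrK.
case: c => -[] y /= y1; rewrite /decode /proj_pt /=.
  rewrite (negPf al0) /= alz padic_absM hD ifF ?mulfK ?padic_abs_half_neq0//.
  apply/negbTE; rewrite -ltNge ltr_pdivrMr// mul1r.
  by rewrite (le_lt_trans y1)// ltr1n.
rewrite mulf_eq0 (negPf al0) /=; have [->//|y0] := eqVneq y 0.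
have -> : (1 - be * y) / (al * y) = (y^-1 - be) / al.
  have -> : y^-1 - be = (1 - be * y) / y by rewrite mulrBl div1r mulfK.
  by rewrite invfM -mulrA [y^-1 * _]mulrC.
by rewrite /= alz padic_absV invf_ge1 ?padic_abs_gt0// y1 invrK.
Qed.

Definition chart_ball n x := [set x' | (enc x').1 = (enc x).1 /\
  padic_abs ((enc x').2 - (enc x).2) <= 2 ^- n].

(** This and [chart_ball_base] make the chart a homeomorphism onto two disjoint copies of the unit
    ball. *)
Lemma chart_ball_nbhs n x : nbhs x (chart_ball n x).
Proof.
have aal : 0 < padic_abs al by rewrite padic_abs_gt0.
case: x => [z0|].
  (* Then [w - w0] is below [2 ^- n.+1 <= 2^-1], which keeps [w] on the same side of 1; the spare
     factor 2 pays for the division by [D] when [p = 1]. *)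
  apply/nbhs_fin; exists (2 ^- n.+1 / padic_abs al).
    by rewrite divr_gt0// invr_gt0 exprn_gt0.
  move=> z; rewrite ltr_pdivlMr// mulrC -padic_absM.
  have -> : al * (z - z0) = (al * z + be) - (al * z0 + be) by ring.
  rewrite /chart_ball /=; set w := al * z + be; set w0 := al * z0 + be => ww.
  have le2 : 2 ^- n.+1 <= 2 ^- 1 :> rat.
    by rewrite lef_pV2 ?qualifE/= ?exprn_gt0// ler_eXn2l.
  have ww1 := lt_le_trans ww le2.
  have lt1 : 2 ^- 1 < 1 :> rat by [].
  have wE : w = w0 + (w - w0) by ring.
  have [w1|w1] := leP 1 (padic_abs w0).
    have aw : padic_abs w = padic_abs w0.
      by rewrite wE padic_absD_dom// (lt_trans ww1)// (lt_le_trans lt1).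
    rewrite aw w1 /=; split => //.
    have w00 : w0 != 0 by rewrite -padic_abs_gt0 (lt_le_trans _ w1).
    have w01 : w != 0 by rewrite -padic_abs_gt0 aw padic_abs_gt0.
    have -> : w^-1 - w0^-1 = (w0 - w) / (w * w0).
      by rewrite mulrBl invfM mulrCA mulfV// mulr1 mulrA mulfV ?mul1r.
    have pw0 : 0 < padic_abs w0 by rewrite padic_abs_gt0.
    rewrite padic_abs_div padic_absM aw ler_pdivrMr; last exact: mulr_gt0.
    rewrite padic_absB; apply: le_trans (ltW ww) _.
    apply: (@le_trans _ _ (2 ^- n)).
      by rewrite lef_pV2 ?qualifE/= ?exprn_gt0// ler_eXn2l.
    by rewrite ler_peMr ?invr_ge0 ?exprn_ge0// mulr_ege1.
  have w2 : padic_abs w < 1.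
    by rewrite wE; apply: padic_abs_lt_add => //; exact: lt_trans ww1 lt1.
  rewrite !ifF /=; [|by apply/negbTE; rewrite -ltNge..].
  split => //; rewrite -mulrBl padic_abs_div hD invrK -ler_pdivlMr//.
  by rewrite -invfM -exprSr ltW.
apply/nbhs_infty.
(* Beyond these bounds [al * z] dominates [be] and exceeds [2 ^+ n], so the inverse of [w] is within
   [2 ^- n] of 0. *)
have [N NP] := exists_pow2_gt (padic_abs be / padic_abs al).
have [M MP] := exists_pow2_gt (2 ^+ n / padic_abs al).
exists (maxn N M).
  by split => //=; rewrite subrr padic_abs0 invr_ge0 exprn_ge0.
move=> z zN; have azr r : r / padic_abs al < padic_abs z -> r < padic_abs (al * z).
  by move=> h; rewrite padic_absM mulrC -ltr_pdivrMr.
have zbe : padic_abs be < padic_abs (al * z).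
  by apply: azr; apply: lt_trans zN; apply: NP; exact: leq_maxl.
have zn : 2 ^+ n < padic_abs (al * z).
  by apply: azr; apply: lt_trans zN; apply: MP; exact: leq_maxr.
have w1 : 1 <= padic_abs (al * z + be).
  by rewrite padic_absD_dom//; apply: le_trans (ltW zn); rewrite exprn_ege1.
rewrite /chart_ball /= w1 /= subr0 padic_absV; split => //.
by rewrite padic_absD_dom// lef_pV2 ?qualifE/= ?exprn_gt0 ?(ltW zn)// (lt_trans _ zn)// exprn_gt0.
Qed.

Lemma chart_ball_base x U : nbhs x U -> exists n, chart_ball n x `<=` U.
Proof.
have aal : 0 < padic_abs al by rewrite padic_abs_gt0.
case: x => [z0|].
  move=> /nbhs_fin[e e0 eU].
  have close z : padic_abs ((al * z + be) - (al * z0 + be)) < e * padic_abs al ->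
      U (fin z).
    have -> : (al * z + be) - (al * z0 + be) = (z - z0) * al by ring.
    by rewrite padic_absM ltr_pM2r//; exact: eU.
  rewrite /chart_ball /=; move: close; set w0 := al * z0 + be => close.
  have [w1|w1] := leP 1 (padic_abs w0).
    have w0p : 0 < padic_abs w0 by rewrite (lt_le_trans _ w1).
    have w00 : w0 != 0 by rewrite -padic_abs_gt0.
    (* The first bound forces [padic_abs w = padic_abs w0] and rules out infinity; the second turns
       closeness of the inverses into closeness of [w] to [w0]. *)
    pose r := Num.min (padic_abs w0)^-1 (e * padic_abs al / padic_abs w0 ^+ 2).
    have r0 : 0 < r.
      rewrite lt_min invr_gt0 w0p /=; apply: divr_gt0; first exact: mulr_gt0.
      exact: exprn_gt0.
    have [n nr] := exists_pow2_lt r0; exists n => -[z|] /= [].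
      set w := al * z + be; case: ifP => //= w1' _ wn.
      apply: close; rewrite -/w.
      have w01 : w != 0 by rewrite -padic_abs_gt0 (lt_le_trans _ w1').
      have := le_lt_trans wn nr; rewrite lt_min => /andP[h1 h2].
      have wE : w^-1 = w0^-1 + (w^-1 - w0^-1) by ring.
      have aw : padic_abs w = padic_abs w0.
        apply: invr_inj; rewrite -!padic_absV wE padic_absD_dom//.
        by rewrite padic_absV.
      have -> : w - w0 = - (w^-1 - w0^-1) * (w0 * w).
        by rewrite opprB mulrBl mulKf// mulrCA mulVf// mulr1.
      rewrite padic_absM padic_absN padic_absM aw -expr2.
      by rewrite -ltr_pdivlMr// exprn_gt0.
    move=> _; rewrite sub0r padic_absN padic_absV => h.
    by have := le_lt_trans h nr; rewrite lt_min ltxx.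
  have [n nr] := exists_pow2_lt (mulr_gt0 e0 aal).
  exists n => -[z|] /= []//; set w := al * z + be; case: ifP => //= w1' _ wn.
  apply: close; rewrite -/w; apply: le_lt_trans nr; apply: le_trans wn.
  by rewrite -mulrBl padic_abs_div hD invrK ler_peMr// padic_abs_ge0.
move=> /nbhs_infty[N Uoo NU].
have [n nP] := exists_pow2_gt (Num.max (padic_abs be) (2 ^+ N * padic_abs al)).
exists n; rewrite /chart_ball => -[z /= []|_ //]; set w := al * z + be; case: ifP => //= w1 _.
rewrite subr0 padic_absV => wn; apply: NU.
have w0 : 0 < padic_abs w by rewrite (lt_le_trans _ w1).
have : 2 ^+ n <= padic_abs w.
  by move: wn; rewrite lef_pV2 ?qualifE/= ?exprn_gt0.
move=> /(lt_le_trans (nP n (leqnn n))); rewrite gt_max => /andP[h1 h2].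
rewrite -(ltr_pM2r aal) -padic_absM; apply: lt_le_trans h2 _.
have -> : z * al = w - be by rewrite /w addrK mulrC.
have h : padic_abs (- be) < padic_abs w by rewrite padic_absN.
by rewrite (padic_absD_dom h) lexx.
Qed.

End Chart.

(** * Rotations of the unit ball *)

Section RotationAlgebra.
Context {F : fieldType}.
Implicit Types D u v y : F.

(* [(1 + y * s) * (1 + u * s)] is proportional to [1 + rotation D u y * s] when
   [s ^+ 2 = D]. *)
Definition rotation D u y := (y + u) / (1 + D * u * y).

(** Associativity of the product of [1 + u * s], [1 + v * s] and [1 + y * s]. *)
Lemma rotation_comp D u v y :
  1 + D * v * y != 0 -> 1 + D * u * v != 0 ->
  1 + D * u * rotation D v y != 0 -> 1 + D * rotation D u v * y != 0 ->
  rotation D u (rotation D v y) = rotation D (rotation D u v) y.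
Proof.
rewrite /rotation => h1 h2 h3 h4.
have n0 : 1 + D * v * y + D * u * (y + v) != 0.
  apply: contraNneq h3 => e; rewrite -[X in X + _](divff h1) mulrA -mulrDl e.
  by rewrite mul0r.
field; rewrite h1 h2 andbT /=; apply: contraNneq n0 => e.
apply/eqP; rewrite -[RHS]e; ring.
Qed.

Lemma rotation_sub D u y : 1 + D * u * y != 0 ->
  rotation D u y - y = u * (1 - D * y ^+ 2) / (1 + D * u * y).
Proof. by rewrite /rotation => h; field. Qed.

Lemma rotation_inj D u y z : 1 + D * u * y != 0 -> 1 + D * u * z != 0 ->
  rotation D u y - rotation D u z =
  (y - z) * (1 - D * u ^+ 2) / ((1 + D * u * y) * (1 + D * u * z)).
Proof. by rewrite /rotation => h1 h2; field; rewrite h1 h2. Qed.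

Lemma rotation_approx D u y : 1 + D * u * y != 0 ->
  rotation D u y - y - u = u * D * (- y * (y + u)) / (1 + D * u * y).
Proof. by rewrite /rotation => h; field. Qed.

Lemma rotation0 D y : rotation D 0 y = y.
Proof. by rewrite /rotation mulr0 mul0r !addr0 divr1. Qed.

End RotationAlgebra.

Section Rotation.
Context (D : Q2) (hD : padic_abs D = 2^-1).
Implicit Types u v y : Q2.
Local Notation rot := (rotation D).
Local Notation int2 y := (padic_abs y <= 1).

Lemma denom_abs u y : int2 u -> int2 y -> padic_abs (1 + D * u * y) = 1.
Proof.
move=> u1 y1; rewrite padic_absD_dom padic_abs1// -mulrA padic_absM hD.
rewrite padic_absM ltr_pdivrMl// mulr1.
have uy : padic_abs u * padic_abs y <= 1.
  by apply: mulr_ile1 => //; exact: padic_abs_ge0.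
by apply: le_lt_trans uy _; rewrite ltr1n.
Qed.

Lemma denom_neq0 u y : int2 u -> int2 y -> 1 + D * u * y != 0.
Proof. by move=> u1 y1; rewrite -padic_abs_gt0 denom_abs. Qed.

Lemma num_abs y : int2 y -> padic_abs (1 - D * y ^+ 2) = 1.
Proof.
move=> y1; have := @denom_abs (- y) y; rewrite padic_absN => /(_ y1 y1) <-.
by rewrite mulrN mulNr -mulrA -expr2.
Qed.

Lemma rotation_le1 u y : int2 u -> int2 y -> int2 (rot u y).
Proof.
move=> u1 y1; rewrite /rotation padic_abs_div denom_abs// divr1.
exact: padic_abs_le_add.
Qed.

Lemma rotation_sub_abs u y : int2 u -> int2 y ->
  padic_abs (rot u y - y) = padic_abs u.
Proof.
move=> u1 y1; rewrite rotation_sub ?denom_neq0// padic_abs_div padic_absM.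
by rewrite denom_abs// num_abs// divr1 mulr1.
Qed.

Lemma rotation_isometry u y z : int2 u -> int2 y -> int2 z ->
  padic_abs (rot u y - rot u z) = padic_abs (y - z).
Proof.
move=> u1 y1 z1; rewrite rotation_inj ?denom_neq0// padic_abs_div !padic_absM.
by rewrite !denom_abs// num_abs// !mulr1.
Qed.

(** To first order the rotation is the translation by [u]; the error carries a factor [D], hence the
    gain of 2. *)
Lemma rotation_approx_abs u y : int2 u -> int2 y ->
  padic_abs (rot u y - y - u) <= padic_abs u / 2.
Proof.
move=> u1 y1; rewrite rotation_approx ?denom_neq0// padic_abs_div denom_abs//.
rewrite divr1 padic_absM padic_absM hD ler_piMr//.
  by rewrite divr_ge0// padic_abs_ge0.
rewrite padic_absM padic_absN.
by apply: mulr_ile1; rewrite ?padic_abs_ge0 ?padic_abs_le_add.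
Qed.

(** Up to a scalar, [(1 + u * s) ^ n] is [1 + rot_sum u n * s]: this is the [n]-fold multiple of [u]
    for the group law [rotation]. *)
Definition rot_sum u n := iter n (rot u) 0.

Lemma rot_sum_le1 u n : int2 u -> int2 (rot_sum u n).
Proof.
by move=> u1; elim: n => [|n IH]; rewrite ?padic_abs0//=; exact: rotation_le1.
Qed.

Lemma iter_rotation u n y : int2 u -> int2 y ->
  iter n (rot u) y = rot (rot_sum u n) y.
Proof.
move=> u1 y1; elim: n => [|n IH]; first by rewrite rotation0.
have s1 := rot_sum_le1 n u1.
by rewrite /= IH rotation_comp// denom_neq0// rotation_le1.
Qed.

(** Doubling sends [v] to [2 * v / (1 + D * v ^ 2)], whose denominator is a unit. *)
Lemma rot_sum_double u n : int2 u ->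
  padic_abs (rot_sum u n.*2) = padic_abs (rot_sum u n) / 2.
Proof.
move=> u1; have s1 := rot_sum_le1 n u1.
rewrite /rot_sum -addnn iterD iter_rotation// -/(rot_sum u n) /rotation.
have -> : rot_sum u n + rot_sum u n = 2 * rot_sum u n by ring.
by rewrite padic_abs_div denom_abs// divr1 padic_absM padic_abs2 mulrC.
Qed.

Lemma rot_sum_le u n : int2 u -> padic_abs (rot_sum u n) <= padic_abs u.
Proof.
move=> u1; elim: n => [|n IH]; first by rewrite padic_abs0 padic_abs_ge0.
rewrite /= {1}/rotation padic_abs_div denom_abs ?rot_sum_le1// divr1.
exact: padic_abs_le_add.
Qed.

(** The even multiple has size at most half that of [u], so the last summand [u] dominates. *)
Lemma rot_sum_odd u n : int2 u -> u != 0 ->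
  padic_abs (rot_sum u n.*2.+1) = padic_abs u.
Proof.
move=> u1 u0; have s1 := rot_sum_le1 n.*2 u1.
rewrite /rot_sum iterS -/(rot_sum u n.*2) /rotation padic_abs_div denom_abs//.
rewrite divr1 addrC.
suff : padic_abs (rot_sum u n.*2) < padic_abs u by exact: padic_absD_dom.
rewrite rot_sum_double//.
have au : 0 < padic_abs u by rewrite padic_abs_gt0.
rewrite ltr_pdivrMr//; apply: le_lt_trans (rot_sum_le n u1) _.
by rewrite ltr_pMr// ltr1n.
Qed.

(** Induction on [s]: an odd [n] gives exactly the size of [u], and an even [n] reduces to [n./2] by
    the doubling formula. *)
Lemma rot_sum_abs_le u s n : int2 u -> u != 0 ->
  (padic_abs (rot_sum u n) <= padic_abs u / 2 ^+ s) = (2 ^ s %| n)%N.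
Proof.
move=> u1 u0; have au : 0 < padic_abs u by rewrite padic_abs_gt0.
elim: s n => [|s IH] n.
  by rewrite expn0 dvd1n divr1 rot_sum_le.
have s2 : 2 ^+ s.+1 = 2 * 2 ^+ s :> rat by rewrite exprS.
have [no|ne] := boolP (odd n).
  have -> : (2 ^ s.+1 %| n)%N = false.
    apply/negP => h; have : (2 %| n)%N by apply: dvdn_trans h; rewrite expnS dvdn_mulr.
    by rewrite dvdn2 no.
  rewrite -[n]odd_double_half no add1n rot_sum_odd//; apply/negbTE.
  by rewrite -ltNge ltr_pdivrMr ?exprn_gt0// ltr_pMr// exprn_egt1.
have nE : n = n./2.*2 by rewrite -{1}[n]odd_double_half (negPf ne).
rewrite nE rot_sum_double// -[in RHS]muln2 expnSr dvdn_pmul2r// -IH.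
by rewrite s2 invfM [2^-1 * _]mulrC mulrA ler_pM2r ?invr_gt0.
Qed.

Lemma rot_sum_pow2 u s : int2 u -> u != 0 ->
  padic_abs (rot_sum u (2 ^ s)) = padic_abs u / 2 ^+ s.
Proof.
move=> u1 u0; elim: s => [|s IH].
  by rewrite expn0 -[1%N]/(0.*2.+1) rot_sum_odd// divr1.
by rewrite expnS mul2n rot_sum_double// IH exprSr invfM mulrA.
Qed.

End Rotation.

(** * Levels of a rotation acting on the two charts *)

Definition rot_step (D u : Q2) (f : bool) (c : bool * Q2) : bool * Q2 :=
  (c.1 (+) f, rotation D u c.2).

(* When the step exchanges the two charts, the residue of [y + p * u] modulo
   [2 ^ k.+1] is invariant and labels the minimal components. *)
Definition chart_level (k : nat) (u : Q2) (f : bool) (s : nat) (c : bool * Q2)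
    : nat :=
  if f && (s == 0%N) then residue k.+1 (c.2 + c.1%:R * u)
  else (c.1 + 2 * residue (k + s) c.2)%N.

Section Levels.
Context (D u : Q2) (k : nat) (f : bool).
Context (hD : padic_abs D = 2^-1) (hu : padic_abs u = 2 ^- k).
Local Notation int2 y := (padic_abs y <= 1).
Local Notation step := (rot_step D u f).
Local Notation lev := (chart_level k u f).
Implicit Types c : bool * Q2.

Lemma pow2V_le1 n : 2 ^- n <= 1 :> rat.
Proof. by rewrite invf_le1 ?exprn_gt0// exprn_ege1. Qed.

Lemma pow2V_le m n : (2 ^- m <= 2 ^- n :> rat) = (n <= m)%N.
Proof. by rewrite lef_pV2 ?qualifE/= ?exprn_gt0// ler_eXn2l. Qed.

Lemma padic_abs_pow2V_le1 : int2 u.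
Proof. by rewrite hu pow2V_le1. Qed.

Lemma padic_abs_pow2V_neq0 : u != 0.
Proof. by rewrite -padic_abs_gt0 hu invr_gt0 exprn_gt0. Qed.

Lemma step_le1 c : int2 c.2 -> int2 (step c).2.
Proof. by move=> c1; apply: rotation_le1 => //; exact: padic_abs_pow2V_le1. Qed.

Lemma iter_stepE n c :
  iter n step c = (c.1 (+) (odd n && f), iter n (rotation D u) c.2).
Proof.
elim: n => [|n IH]; first by rewrite addbF -surjective_pairing.
by rewrite /= IH /rot_step /=; congr (_, _); case: c.1 f (odd n) => [] [] [].
Qed.

Lemma iter_step_le1 n c : int2 c.2 -> int2 (iter n step c).2.
Proof. by move=> c1; elim: n => //= n; exact: step_le1. Qed.

Lemma iter_step_abs n c : int2 c.2 ->
  padic_abs ((iter n step c).2 - c.2) = padic_abs (rot_sum D u n).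
Proof.
move=> c1; rewrite iter_stepE /= iter_rotation ?padic_abs_pow2V_le1//.
by rewrite rotation_sub_abs// rot_sum_le1// padic_abs_pow2V_le1.
Qed.

Lemma shifted_le1 c : int2 c.2 -> int2 (c.2 + c.1%:R * u).
Proof.
move=> c1; apply: padic_abs_le_add => //.
by case: c.1; rewrite ?mul1r ?mul0r ?padic_abs0// padic_abs_pow2V_le1.
Qed.

(** Away from the shifted label, the parity of a label is the chart and its half is the residue. *)
Lemma level_eqS s c c' : ~~ (f && (s == 0%N)) -> int2 c.2 -> int2 c'.2 ->
  lev s c = lev s c' <-> c.1 = c'.1 /\ padic_abs (c.2 - c'.2) <= 2 ^- (k + s).
Proof.
move=> fs c1 c'1; rewrite /chart_level (negPf fs).
have [h1 h2] := residue_eq (k + s) c1 c'1.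
split=> [e|[-> /h2 -> //]].
have e1 : c.1 = c'.1.
  by have := congr1 odd e; rewrite !mul2n !oddD !odd_double !addbF !oddb.
split=> //; apply: h1; move: e; rewrite e1 => /addnI/eqP.
by rewrite eqn_mul2l => /eqP.
Qed.

Lemma level_eq0 c c' : f -> int2 c.2 -> int2 c'.2 -> lev 0 c = lev 0 c' <->
  padic_abs (c.2 + c.1%:R * u - (c'.2 + c'.1%:R * u)) <= 2 ^- k.+1.
Proof.
move=> f1 c1 c'1; rewrite /chart_level f1 /=.
by apply: residue_eq; exact: shifted_le1.
Qed.

(** Within one chart the shift [p * u] cancels, so level [0] already has the precision [2 ^- k.+1]
    of level [1]. *)
Lemma level_eq0_same c c' : f -> int2 c.2 -> int2 c'.2 -> c.1 = c'.1 ->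
  lev 0 c = lev 0 c' <-> padic_abs (c.2 - c'.2) <= 2 ^- k.+1.
Proof.
move=> f1 c1 c'1 e; rewrite level_eq0// e.
by have -> : c.2 + c'.1%:R * u - (c'.2 + c'.1%:R * u) = c.2 - c'.2 by ring.
Qed.

(** If the charts are kept, [y] moves by exactly [2 ^- k]. If they are exchanged, the rotation adds
    [u] modulo [2 ^ k.+1], and the change of [p * u] turns this into [0] or [2 * u], which also
    vanishes there. *)
Lemma level0_step c : int2 c.2 -> lev 0 (step c) = lev 0 c.
Proof.
move=> c1; have s1 := step_le1 c1.
have [f1|f1] : ~~ f \/ f by case: (f); [right|left].
  have fs : ~~ (f && (0 == 0)%N) by rewrite andbT.
  apply/(level_eqS fs s1 c1); rewrite /= (negPf f1) addbF; split=> //.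
  by rewrite rotation_sub_abs ?padic_abs_pow2V_le1// addn0 hu.
apply/(level_eq0 f1 s1 c1); rewrite /rot_step f1 addbT /=.
have h : padic_abs (rotation D u c.2 - c.2 - u) <= 2 ^- k.+1.
  by rewrite exprSr invfM -hu rotation_approx_abs// padic_abs_pow2V_le1.
case: c.1 => /=; rewrite ?mul1r ?mul0r.
  by have -> : rotation D u c.2 + 0 - (c.2 + u) = rotation D u c.2 - c.2 - u by ring.
have -> : rotation D u c.2 + u - (c.2 + 0) =
  (rotation D u c.2 - c.2 - u) + 2 * u by ring.
apply: padic_abs_le_add => //.
by rewrite padic_absM padic_abs2 hu exprS invfM.
Qed.

Lemma level_compat s c c' : int2 c.2 -> int2 c'.2 ->
  lev s c = lev s c' -> lev s (step c) = lev s (step c').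
Proof.
move=> c1 c'1; have [s1 s1'] := (step_le1 c1, step_le1 c'1).
case: (boolP (f && (s == 0%N))) => [/andP[f1 /eqP->]|fs].
  by rewrite !level0_step.
move/(level_eqS fs c1 c'1) => [e h]; apply/(level_eqS fs s1 s1').
by rewrite /= e rotation_isometry ?padic_abs_pow2V_le1.
Qed.

Lemma level0_iter n c : int2 c.2 -> lev 0 (iter n step c) = lev 0 c.
Proof.
move=> c1; elim: n => //= n <-; apply: level0_step; exact: iter_step_le1.
Qed.

Lemma level_period s n c : int2 c.2 ->
  lev s (iter n step c) = lev s c <-> (2 ^ s %| n)%N.
Proof.
move=> c1; have n1 := iter_step_le1 n c1.
case: (boolP (f && (s == 0%N))) => [/andP[f1 /eqP->]|fs].
  by rewrite expn0 dvd1n level0_iter.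
have E : (padic_abs ((iter n step c).2 - c.2) <= 2 ^- (k + s)) = (2 ^ s %| n)%N.
  rewrite iter_step_abs// -(rot_sum_abs_le hD _ _ padic_abs_pow2V_le1 padic_abs_pow2V_neq0) hu.
  by rewrite exprD invfM.
split=> [/(level_eqS fs n1 c1)[_]|h]; first by rewrite E.
apply/(level_eqS fs n1 c1); rewrite E; split=> //.
(* The chart returns too: if [f] holds then [s] is positive, so [n] is even. *)
rewrite iter_stepE /=; case: (f) fs => /=; last by rewrite andbF addbF.
rewrite -lt0n => s0; have : (2 %| n)%N.
  by apply: dvdn_trans h; rewrite -(prednK s0) expnS dvdn_mulr.
by rewrite dvdn2 => /negPf ->; rewrite addbF.
Qed.

Lemma level_refine s c c' : int2 c.2 -> int2 c'.2 ->
  lev s.+1 c = lev s.+1 c' -> lev s c = lev s c'.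
Proof.
move=> c1 c'1; have fS : ~~ (f && (s.+1 == 0%N)) by rewrite andbF.
move=> /(level_eqS fS c1 c'1) [e h].
case: (boolP (f && (s == 0%N))) => [/andP[f1 /eqP s0]|fs].
  by rewrite s0 addn1 in h; rewrite s0; apply/(level_eq0_same f1 c1 c'1 e).
by apply/(level_eqS fs c1 c'1); split=> //; apply: le_trans h _; rewrite pow2V_le leq_add2l.
Qed.

Lemma level_split s c c' : int2 c.2 -> int2 c'.2 -> lev s c = lev s c' ->
  lev s.+1 c = lev s.+1 c' \/ lev s.+1 (iter (2 ^ s) step c) = lev s.+1 c'.
Proof.
move=> c1 c'1.
have n1 := iter_step_le1 (2 ^ s) c1.
have fS : ~~ (f && (s.+1 == 0%N)) by rewrite andbF.
case: (boolP (f && (s == 0%N))) => [/andP[f1 /eqP s0]|fs].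
  (* When charts are exchanged, equal labels at level [0] can differ at level [1] only by the chart,
     which one step corrects. *)
  rewrite {}s0 in n1 fS * => e; have [p|p] := eqVneq c.1 c'.1.
    left; apply/(level_eqS fS c1 c'1); split=> //; rewrite addn1.
    exact/(level_eq0_same f1 c1 c'1 p).
  right; have p' : (step c).1 = c'.1.
    by rewrite /= f1 addbT; case: c.1 c'.1 p => [] [].
  apply/(level_eqS fS n1 c'1); split=> //; rewrite addn1.
  by apply/(level_eq0_same f1 n1 c'1 p'); rewrite /= level0_step.
move/(level_eqS fs c1 c'1) => [e h].
(* The iterate moves [y] by exactly [2 ^- (k + s)], so it toggles the next binary digit of
   [c.2 - c'.2]. *)
have hn : padic_abs ((iter (2 ^ s) step c).2 - c.2) = 2 ^- (k + s).
  rewrite iter_step_abs// rot_sum_pow2 ?padic_abs_pow2V_le1 ?padic_abs_pow2V_neq0// hu.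
  by rewrite exprD invfM.
have [h1|h1] := padic_abs_le_or_addr h hn.
  by left; apply/(level_eqS fS c1 c'1); rewrite addnS.
right; apply/(level_eqS fS n1 c'1); rewrite addnS; split.
  rewrite iter_stepE /= e; case: (f) fs => /=; last by rewrite andbF addbF.
  by rewrite -lt0n => s0; rewrite -(prednK s0) expnS oddM /= addbF.
by move: h1; have -> : c.2 - c'.2 + ((iter (2 ^ s) step c).2 - c.2) =
  (iter (2 ^ s) step c).2 - c'.2 by ring.
Qed.

(** Exchanged charts give the residues modulo [2 ^ k.+1]; preserved charts give two copies of the
    residues modulo [2 ^ k]. *)
Lemma level0_count i :
  (i < 2 ^ k.+1)%N <-> exists2 c, int2 c.2 & lev 0 c = i.
Proof.
rewrite /chart_level; case: (f) => /=; split.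
- move=> ik; exists (false, i%:R); first exact: padic_abs_nat_le1.
  by rewrite /= mul0r addr0 residue_nat modn_small.
- by move=> [c _ <-]; exact: residue_lt.
- move=> ik; exists (odd i, i./2%:R); first exact: padic_abs_nat_le1.
  rewrite /= addn0 residue_nat modn_small ?mul2n ?odd_double_half//.
  by rewrite -(@ltn_pmul2l 2)// -expnS (leq_ltn_trans _ ik)// mul2n -{2}[i]odd_double_half leq_addl.
- move=> [c _ <-]; rewrite addn0 expnS.
  by have := residue_lt k c.2; case: c.1 => /=; lia.
Qed.

End Levels.

(** * Conjugation of the homography to a rotation *)

(* In the coordinate [w = al * z + be] the map reads [(T * w + D) / (w + T)],
   multiplication by [T + s] on the classes of [w + s]; both identities hold up
   to the factor [mu / 2]. *)
Lemma mobius_coord_num {F : fieldType} (a b c d mu W V : F) :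
  (2 : F) != 0 -> mu != 0 ->
  a * (W - (d - a) / mu * V) + b * (2 * c / mu * V) =
  mu / 2 * ((a + d) / mu * W + ((d - a) ^+ 2 + 4 * b * c) / mu ^+ 2 * V
            - (d - a) / mu * (W + (a + d) / mu * V)).
Proof. by move=> h2 hm; field; rewrite hm. Qed.

Lemma mobius_coord_den {F : fieldType} (a c d mu W V : F) :
  (2 : F) != 0 -> mu != 0 ->
  c * (W - (d - a) / mu * V) + d * (2 * c / mu * V) =
  mu / 2 * (2 * c / mu * (W + (a + d) / mu * V)).
Proof. by move=> h2 hm; field; rewrite hm. Qed.

Section Conjugation.
Context (a b c d mu : Q2) (c0 : c != 0) (mu0 : mu != 0).
Local Notation al := (2 * c / mu).
Local Notation be := ((d - a) / mu).
Local Notation D := (disc a b c d / mu ^+ 2).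
Local Notation T := ((a + d) / mu).

Lemma chart_scale_neq0 : al != 0.
Proof. exact: mulf_neq0 (mulf_neq0 Q2_2neq0 c0) (invr_neq0 mu0). Qed.

Lemma mobius_coord W V : (W != 0) || (V != 0) ->
  mobius a b c d (proj_pt (W - be * V) (al * V)) =
  proj_pt (T * W + D * V - be * (W + T * V)) (al * (W + T * V)).
Proof.
move=> WV; rewrite mobius_proj_pt; last first.
  rewrite mulf_eq0 (negPf chart_scale_neq0) /=.
  have [V0|V0] := eqVneq V 0; last by rewrite orbT.
  by move: WV; rewrite V0 eqxx mulr0 subr0.
rewrite (mobius_coord_num a b c d W V Q2_2neq0 mu0).
rewrite (mobius_coord_den a c d W V Q2_2neq0 mu0) proj_pt_scale; first by [].
exact: mulf_neq0 mu0 (invr_neq0 Q2_2neq0).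
Qed.

Context (hD : padic_abs D = 2^-1).

(** The condition on [u] says that [T + s] is [s * (1 + u * s)] when [f] holds and [T * (1 + u * s)]
    otherwise. In each of the four cases the two sides have proportional homogeneous coordinates. *)
Lemma mobius_decode (f : bool) (u : Q2) (p : bool * Q2) :
  padic_abs u <= 1 -> (if f then T = D * u else T * u = 1) ->
  padic_abs p.2 <= 1 ->
  mobius a b c d (decode al be D p) = decode al be D (rot_step D u f p).
Proof.
case: p => p y u1 hT /= y1; have N0 := denom_neq0 hD u1 y1.
rewrite /rot_step /=; set y' := rotation D u y.
have hy : (1 + D * u * y) * y' = y + u by rewrite mulrC divfK.
have D0 := padic_abs_half_neq0 hD.
case: p f hT => -[] /= hT; rewrite /decode /=.
- have := @mobius_coord (y * D) 1; rewrite !mulr1 oner_eq0 orbT => -> //.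
  rewrite -[RHS](@proj_pt_scale _ _ _ (mulf_neq0 D0 N0)).
  have -> : D * (1 + D * u * y) * (1 - be * y') =
    D * (1 + D * u * y) - D * be * ((1 + D * u * y) * y') by ring.
  have -> : D * (1 + D * u * y) * (al * y') =
    D * al * ((1 + D * u * y) * y') by ring.
  by rewrite hy hT; congr proj_pt; ring.
- have T0 : T != 0 by apply/eqP => T0; move/eqP: hT; rewrite T0 mul0r eq_sym oner_eq0.
  have := @mobius_coord (y * D) 1; rewrite !mulr1 oner_eq0 orbT => -> //.
  rewrite -[RHS](@proj_pt_scale _ _ _ (mulf_neq0 T0 N0)).
  have -> : T * (1 + D * u * y) * (y' * D - be) =
    T * D * ((1 + D * u * y) * y') - be * (T + D * y * (T * u)) by ring.
  have -> : T * (1 + D * u * y) * al = al * (T + D * y * (T * u)) by ring.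
  rewrite hy; have -> : T * D * (y + u) = T * D * y + D * (T * u) by ring.
  by rewrite hT; congr proj_pt; ring.
- rewrite mobius_coord ?oner_eq0//.
  rewrite -[RHS](@proj_pt_scale _ _ _ N0).
  have -> : (1 + D * u * y) * (y' * D - be) =
    D * ((1 + D * u * y) * y') - be * (1 + D * u * y) by ring.
  by rewrite hy hT; congr proj_pt; ring.
- have T0 : T != 0 by apply/eqP => T0; move/eqP: hT; rewrite T0 mul0r eq_sym oner_eq0.
  rewrite mobius_coord ?oner_eq0//.
  rewrite -[RHS](@proj_pt_scale _ _ _ (mulf_neq0 T0 N0)).
  have -> : T * (1 + D * u * y) * (1 - be * y') =
    T + D * y * (T * u) - T * be * ((1 + D * u * y) * y') by ring.
  have -> : T * (1 + D * u * y) * (al * y') =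
    T * al * ((1 + D * u * y) * y') by ring.
  rewrite hy.
  have -> : T * be * (y + u) = be * (T * y + T * u) by ring.
  have -> : T * al * (y + u) = al * (T * y + T * u) by ring.
  by rewrite hT; congr proj_pt; ring.
Qed.

Lemma mobius_levels (f : bool) (u : Q2) (k : nat) :
  padic_abs u = 2 ^- k -> (if f then T = D * u else T * u = 1) ->
  dyadic_levels (mobius a b c d)
    (fun s x => chart_level k u f s (encode al be D x)).
Proof.
move=> hu hT; have u1 := padic_abs_pow2V_le1 hu; have al0 := chart_scale_neq0.
pose enc := encode al be D.
have enc1 x : padic_abs (enc x).2 <= 1 by exact: encode_le1.
have encM x : enc (mobius a b c d x) = rot_step D u f (enc x).
  rewrite -[x in LHS](encodeK be al0 hD) (mobius_decode u1 hT (enc1 x)).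
  by apply: decodeK => //; apply: (step_le1 f hD hu); exact: enc1.
have encI n x : enc (iter n (mobius a b c d) x) = iter n (rot_step D u f) (enc x).
  by elim: n => //= n <-.
split.
- move=> s x; apply: filterS (chart_ball_nbhs be al0 hD (k + s).+1 x) => y [/= e h].
  (* Level [s.+1] is compared instead of [s] because its label is never the shifted one. *)
  have fs : ~~ (f && (s.+1 == 0%N)) by rewrite andbF.
  apply: (level_refine hu (enc1 y) (enc1 x)).
  by apply/(level_eqS u k fs (enc1 y) (enc1 x)); rewrite addnS.
- move=> x U /(chart_ball_base be al0 hD)[n nU]; exists n.+1 => y /= e; apply: nU.
  have fn : ~~ (f && (n.+1 == 0%N)) by rewrite andbF.
  move/(level_eqS u k fn (enc1 y) (enc1 x)): e => [e h]; split => //.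
  by apply: le_trans h _; rewrite pow2V_le (leq_trans (leqnSn n))// leq_addl.
- by move=> s x y; exact: (level_refine hu).
- by move=> s x y; rewrite -/enc !encM; exact: (level_compat hD hu).
- by move=> s n x; rewrite -/enc encI; exact: (level_period f hD hu).
- by move=> s x y; rewrite -/enc encI; exact: (level_split hD hu).
- move=> x y xy; rewrite -[x](encodeK be al0 hD) -[y](encodeK be al0 hD).
  have h s : (enc x).1 = (enc y).1 /\
      padic_abs ((enc x).2 - (enc y).2) <= 2 ^- (k + s.+1).
    by apply/(level_eqS u k _ (enc1 x) (enc1 y)); rewrite ?andbF//; exact: xy.
  have [e _] := h 0%N; congr decode; rewrite -/enc.
  suff e2 : (enc x).2 = (enc y).2.
    by rewrite [LHS]surjective_pairing e e2 -surjective_pairing.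
  apply/eqP; rewrite -subr_eq0 -padic_abs_eq0 eq_le padic_abs_ge0 andbT leNgt.
  apply/negP => /exists_pow2_lt[n]; rewrite ltNge => /negP; apply.
  have [_ hn] := h n; apply: le_trans hn _.
  by rewrite pow2V_le (leq_trans (leqnSn n))// leq_addl.
Qed.

Lemma mobius_level0_count (f : bool) (u : Q2) (k : nat) i : (i < 2 ^ k.+1)%N <->
  exists x, chart_level k u f 0 (encode al be D x) = i.
Proof.
rewrite (level0_count u k f); split=> [[p p1 pi]|[x xi]].
  by exists (decode al be D p); rewrite decodeK//; exact: chart_scale_neq0.
exists (encode al be D x) => //.
exact: encode_le1.
Qed.

Lemma mobius_dynamics (f : bool) (u : Q2) (k : nat) :
  padic_abs u = 2 ^- k -> (if f then T = D * u else T * u = 1) ->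
  decomposed (mobius a b c d) (2 ^ k.+1) /\
  (forall E : set P1, E !=set0 -> minimal_subsystem (mobius a b c d) E ->
     topologically_conjugate E (mobius a b c d)
       (odometer (fun s => (2 ^ s)%N)) (adding_machine (fun s => (2 ^ s)%N))).
Proof.
move=> hu hT; have HL := mobius_levels hu hT.
have cP1 : compact [set: P1] := one_point_compactification_compact.
split; last exact: levels_adding_machine HL cP1.
by apply: (levels_decomposed HL cP1) => i; exact: mobius_level0_count.
Qed.

End Conjugation.

(** * Valuations in the quadratic extension *)

(** Horner evaluation stays in the span of [1] and [s], since [(x + y * s) * s + z = (y * m + z) + x
    * s]. *)
Lemma generating_sqrt_span {K : fieldExtType Q2} (m : Q2) (s : K) :
  generating_sqrt m s -> forall v : K, exists x y : Q2, v = x%:A + y%:A * s.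
Proof.
move=> [s2 sK] v; have : v \in <<1%VS; s>>%VS by rewrite sK memvf.
move=> /Fadjoin_polyP[p /polyOver1P[q ->] ->].
elim/poly_ind: q => [|q z [x [y e]]].
  by exists 0, 0; rewrite rmorph0 horner0 scale0r mul0r addr0.
exists (y * m + z), x; rewrite rmorphD rmorphM /= map_polyX map_polyC /=.
have -> : (y * m + z)%:A = y%:A * m%:A + z%:A :> K.
  by rewrite -!in_algE rmorphD rmorphM.
by rewrite hornerMXaddC e mulrDl -mulrA -expr2 s2 -addrA addrC.
Qed.

(** Write [s = x + y * r] and square: [D - x ^ 2 - m * y ^ 2 = 2 * x * y * r]. As [s] is not in
    [Q2], [y] is nonzero and [r] is not in [Q2] either; hence [x = 0] and [D = m * y ^ 2]. *)
Lemma disc_square_class {K : fieldExtType Q2} (D m : Q2) (s r : K) :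
  ~ (exists x : Q2, x ^+ 2 = D) -> generating_sqrt D s -> generating_sqrt m r ->
  exists2 mu : Q2, mu != 0 & D = m * mu ^+ 2.
Proof.
move=> nsq hs hr; have [x [y sE]] := generating_sqrt_span hr s.
have [s2 _] := hs; have [r2 _] := hr.
have notQ (z : Q2) : s != z%:A.
  apply/eqP => e; apply: nsq; exists z; apply: (fmorph_inj (in_alg K)).
  by rewrite rmorphXn /= -e s2.
have y0 : y != 0.
  by apply/eqP => e; have := notQ x; rewrite sE e scale0r mul0r addr0 eqxx.
have E : (D - x ^+ 2 - m * y ^+ 2)%:A = (2 * x * y)%:A * r :> K.
  pose i : {rmorphism Q2 -> K} := in_alg K.
  rewrite -[LHS]/(i _) -[(2 * x * y)%:A]/(i _).
  have eD : i D = s ^+ 2 by rewrite s2.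
  have em : i m = r ^+ 2 by rewrite r2.
  have e2 : i 2 = 2 by rewrite rmorph_nat.
  rewrite rmorphB rmorphB (rmorphXn i) (rmorphM i m) (rmorphXn i).
  rewrite (rmorphM i) (rmorphM i) eD em e2 sE -![_%:A]/(i _); ring.
have x0 : x = 0.
  apply/eqP; apply: contraT => x0.
  have n0 : 2 * x * y != 0 by apply: mulf_neq0 y0; apply: mulf_neq0 x0; exact: Q2_2neq0.
  have rE : r = ((D - x ^+ 2 - m * y ^+ 2) / (2 * x * y))%:A.
    have B0 : (2 * x * y)%:A != 0 :> K by rewrite -in_algE fmorph_eq0.
    by rewrite -in_algE rmorphM fmorphV /= E mulrC mulKf.
  have := notQ (x + y * ((D - x ^+ 2 - m * y ^+ 2) / (2 * x * y))).
  by rewrite sE {1}rE -!in_algE rmorphD rmorphM eqxx.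
exists y => //; apply: (fmorph_inj (in_alg K)).
by rewrite rmorphM rmorphXn /= -s2 -r2 sE x0 scale0r add0r exprMn mulrC.
Qed.

Lemma padic_abs_ramified (m : Q2) :
  [\/ m = 2, m = - 2, m = 6 | m = - 6] -> padic_abs m = 2^-1.
Proof.
have h6 : padic_abs 6 = 2^-1.
  have -> : (6 : Q2) = 2 + 4 by ring.
  rewrite padic_absD_dom padic_abs2//.
  have -> : (4 : Q2) = 2 * 2 by ring.
  by rewrite padic_absM padic_abs2.
by case=> ->; rewrite ?padic_absN ?padic_abs2.
Qed.

Section AbsK.
Context {R : realType} {K : fieldExtType Q2} {absK : K -> R}.
Context (habsK : is_extension_of_padic_abs absK).

Lemma absK_ge0 x : 0 <= absK x. Proof. by have [/(_ x)[]] := habsK. Qed.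

Lemma absK_eq0 x : (absK x == 0) = (x == 0).
Proof.
have [/(_ x)[_ h] _ _ _] := habsK.
by apply/eqP/eqP => /h.
Qed.

Lemma absK_gt0 x : (0 < absK x) = (x != 0).
Proof. by rewrite lt_def absK_ge0 absK_eq0 andbT. Qed.

Lemma absKM x y : absK (x * y) = absK x * absK y.
Proof. by have [_ ->] := habsK. Qed.

Lemma absK_alg q : absK q%:A = ratr (padic_abs q).
Proof. by have [_ _ _ ->] := habsK. Qed.

Lemma absK1 : absK 1 = 1.
Proof. by rewrite -[1 in LHS]scale1r absK_alg padic_abs1 rmorph1. Qed.

Lemma absKN x : absK (- x) = absK x.
Proof.
rewrite -mulN1r absKM -[- 1]scaleN1r -[LHS]/(absK (-1)%:A * _).
by rewrite absK_alg padic_absN padic_abs1 rmorph1 mul1r.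
Qed.

Lemma absKV x : absK x^-1 = (absK x)^-1.
Proof.
have [->|x0] := eqVneq x 0.
  have /eqP -> : absK 0 == 0 by rewrite absK_eq0.
  by rewrite !invr0; apply/eqP; rewrite absK_eq0.
have a0 : absK x != 0 by rewrite absK_eq0.
by apply: (mulIf a0); rewrite -absKM !mulVf// absK1.
Qed.

Lemma absKD_dom x y : absK y < absK x -> absK (x + y) = absK x.
Proof.
move=> yx; have [_ _ D _] := habsK; apply/eqP; rewrite eq_le; apply/andP; split.
  by apply: le_trans (D x y) _; rewrite ge_max lexx ltW.
have := D (x + y) (- y); rewrite addrK absKN le_max => /orP[//|].
by rewrite leNgt yx.
Qed.

End AbsK.

Section RamifiedRoot.
Context {R : realType} {K : fieldExtType Q2} {absK : K -> R}.
Context (habsK : is_extension_of_padic_abs absK).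
Context (D : Q2) (s : K) (hD : padic_abs D = 2^-1) (hs : s ^+ 2 = D%:A).

Lemma ratr_padic_abs_div (x y : Q2) :
  ratr (padic_abs (x / y)) = absK x%:A / absK y%:A :> R.
Proof. by rewrite !(absK_alg habsK) padic_abs_div rmorphM fmorphV. Qed.

Lemma absK_root_sqr : absK s * absK s = 2^-1.
Proof.
rewrite -(absKM habsK) -expr2 hs (absK_alg habsK) hD.
by rewrite fmorphV rmorph_nat.
Qed.

Lemma absK_root_gt0 : 0 < absK s.
Proof.
rewrite lt_def (absK_ge0 habsK) andbT; apply/eqP => e.
have := absK_root_sqr; rewrite e mul0r => /esym/eqP.
by rewrite invr_eq0 pnatr_eq0.
Qed.

Lemma absK_root_lt q : 1 <= padic_abs q -> absK s < ratr (padic_abs q).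
Proof.
rewrite -(ler_rat R) rmorph1 => q1; apply: lt_le_trans q1.
have := absK_root_sqr; have := absK_root_gt0; nra.
Qed.

Lemma absK_root_gt q : padic_abs q < 1 -> ratr (padic_abs q) < absK s.
Proof.
rewrite -padic_abs1 => /padic_abs_gap; rewrite padic_abs1 div1r -(ler_rat R).
rewrite fmorphV rmorph_nat => q1; apply: le_lt_trans q1 _.
have := absK_root_sqr; have := absK_root_gt0; nra.
Qed.

(** The square of [absK s] is [2^-1], so [absK s] lies strictly between the consecutive values
    [2^-1] and [1] of [Q2]. *)
Lemma absK_root_neq q : absK s != ratr (padic_abs q).
Proof.
by have [/absK_root_lt h|/absK_root_gt h] := leP 1 (padic_abs q);
  rewrite ?(lt_eqF h) ?(gt_eqF h).
Qed.

(** When [y] is nonzero the two terms never have equal size, by [absK_root_neq], so the larger one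
    gives the absolute value of the sum. *)
Lemma absK_value_group (x y : Q2) : x%:A + y%:A * s != 0 ->
  exists2 q : Q2, q != 0 & absK (x%:A + y%:A * s) = absK q%:A \/
                           absK (x%:A + y%:A * s) = absK s * absK q%:A.
Proof.
have [->|y0] := eqVneq y 0.
  rewrite scale0r mul0r addr0 -in_algE fmorph_eq0 => x0.
  by exists x => //; left.
have [x0|x0] := leP (absK (y%:A * s)) (absK x%:A); last first.
  move=> _; exists y => //; right.
  by rewrite addrC (absKD_dom habsK)// (absKM habsK) mulrC.
have yA0 : ratr (padic_abs y) != 0 :> R by rewrite fmorph_eq0 padic_abs_eq0.
move: x0; rewrite le_eqVlt => /orP[/eqP e|h _].
  have := absK_root_neq (x / y); rewrite ratr_padic_abs_div -e.
  by rewrite (absKM habsK) mulrC mulKf ?eqxx// (absK_alg habsK).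
exists x; last by left; rewrite (absKD_dom habsK).
apply/eqP => x0; move: h; rewrite x0 (absK_alg habsK) padic_abs0 rmorph0.
by rewrite ltNge (absK_ge0 habsK).
Qed.

(** The values of [1] and [s] lie in different cosets, and [absK_value_group] puts every
    representative in one of these two. *)
Lemma ramification_index2 e :
  (forall v : K, exists x y : Q2, v = x%:A + y%:A * s) ->
  is_ramification_index absK e -> e = 2%N.
Proof.
move=> span [r [r0 rP]].
have s0 : s != 0 by rewrite -(absK_gt0 habsK) absK_root_gt0.
have [i1 [[q1 q10 e1] u1]] := rP 1 (oner_neq0 _).
have [i2 [[q2 q20 e2] u2]] := rP s s0.
have aq0 (q : Q2) : q != 0 -> absK q%:A != 0.
  by move=> q0; rewrite (absK_eq0 habsK) -in_algE fmorph_eq0.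
have i12 : i1 != i2.
  apply/eqP => i12; rewrite -i12 in e2; rewrite (absK1 habsK) in e1.
  have := absK_root_neq (q2 / q1); rewrite ratr_padic_abs_div.
  have -> : absK s = absK q2%:A / absK q1%:A; last by rewrite eqxx.
  rewrite e2 mulrC; congr (_ * _); apply: (mulIf (aq0 _ q10)).
  by rewrite mulVf ?aq0// e1.
have all i : i = i1 \/ i = i2.
  have [x [y rE]] := span (r i).
  have ri0 := r0 i; rewrite rE in ri0.
  have [q q0] := absK_value_group ri0; rewrite -rE => -[h|h].
    left; apply/esym/u1; exists q^-1; first by rewrite invr_neq0.
    by rewrite h (absK1 habsK) (absK_alg habsK) (absK_alg habsK) padic_absV
      fmorphV mulfV// fmorph_eq0 padic_abs_eq0.
  right; apply/esym/u2; exists q^-1; first by rewrite invr_neq0.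
  rewrite h (absK_alg habsK) (absK_alg habsK) padic_absV fmorphV mulfK//.
  by rewrite fmorph_eq0 padic_abs_eq0.
rewrite -(card_ord e) -cardsT.
have -> : [set: 'I_e]%SET = [set i1; i2]%SET.
  by apply/setP => i; rewrite !inE; have [->|->] := all i; rewrite eqxx ?orbT.
by rewrite cards2 i12.
Qed.

(** Here [v2] of [s] is one half, so [v_pi] of [x] is [2 * (1 / 2 + 1 + k) = 2 * k + 3]. *)
Lemma component_count (k : nat) (x : K) : absK x = absK s * 2^-1 * 2 ^- k ->
  (2 ^ k.+1)%N%:R = 2 `^ ((v_pi absK 2 x - 1) / 2) :> R.
Proof.
move=> xE; have sp := absK_root_gt0.
have ln2 : ln 2 != 0 :> R by rewrite gt_eqF// ln_gt0// ltr1n.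
have lns : ln (absK s) *+ 2 = - ln 2.
  by rewrite -lnXn// expr2 absK_root_sqr lnV// posrE.
have lnx : ln (absK x) = ln (absK s) - ln 2 - ln 2 *+ k.
  rewrite xE lnM ?posrE ?mulr_gt0 ?invr_gt0 ?exprn_gt0// lnM ?posrE ?invr_gt0//.
  by rewrite !lnV ?posrE ?exprn_gt0// lnXn.
have -> : (v_pi absK 2 x - 1) / 2 = k.+1%:R.
  rewrite /v_pi /v2 lnx -[ln 2 *+ k]mulr_natr -natr1.
  have -> : ln (absK s) = - ln 2 / 2 by move: lns; rewrite mulr2n => e; lra.
  by field.
by rewrite powR_mulrn// natrX.
Qed.

End RamifiedRoot.

(** * Normalisation of the discriminant and comparison of its root with the trace *)

Lemma padic_abs_le1_ex (x : Q2) : x != 0 -> padic_abs x <= 1 ->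
  exists k : nat, padic_abs x = 2 ^- k.
Proof.
move=> x0; have [[k|k] ->] := padic_abs_ex x0; last by exists k.+1.
rewrite -[X in _ <= X](expr0z (2 : rat)) ler_eXz2l// lez_nat leqn0 => /eqP ->.
by exists 0%N; rewrite invr1.
Qed.

Theorem theorem5p8 (R : realType) (a b c d : Q2) (K : fieldExtType Q2)
    (sqrtD : K) (absK : K -> R) (e : nat) (varpi : K)
    (had_bc : a * d - b * c != 0)
    (hnsq : ~ exists x : Q2, x ^+ 2 = disc a b c d)
    (hsqrtD : generating_sqrt (disc a b c d) sqrtD)
    (habsK : is_extension_of_padic_abs absK)
    (he : is_ramification_index absK e)
    (hvarpi : is_uniformizer absK varpi)
    (hlambda : forall n : nat, (0 < n)%N -> lambda a d sqrtD ^+ n != 1)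
    (hK : [\/ is_Q2_sqrt K 2, is_Q2_sqrt K (-2),
              is_Q2_sqrt K 6 | is_Q2_sqrt K (-6)]) :
  [/\ absK sqrtD != absK (a + d)%:A,
      absK sqrtD < absK (a + d)%:A ->
        exists2 M : nat,
          M%:R = 2 `^ ((v_pi absK e (lambda a d sqrtD - 1) - 1) / 2) :> R
          & decomposed (mobius a b c d) M,
      absK (a + d)%:A < absK sqrtD ->
        exists2 M : nat,
          M%:R = 2 `^ ((v_pi absK e (lambda a d sqrtD + 1) - 1) / 2) :> R
          & decomposed (mobius a b c d) M
    & forall E : set P1, E !=set0 -> minimal_subsystem (mobius a b c d) E ->
        topologically_conjugate E (mobius a b c d)
          (odometer (fun s => (2 ^ s)%N)) (adding_machine (fun s => (2 ^ s)%N))].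
Proof.
have [m [r [hm hr]]] : exists m (r : K), padic_abs m = 2^-1 /\ generating_sqrt m r.
  by case: hK => -[r hr]; eexists; exists r; (split; last exact: hr);
    apply: padic_abs_ramified; constructor.
(* Dividing by [mu ^+ 2] turns the discriminant into [m], of absolute value [2^-1]. *)
have [mu mu0 DE] := disc_square_class hnsq hsqrtD hr.
have hD : padic_abs (disc a b c d / mu ^+ 2) = 2^-1.
  by rewrite DE mulfK ?expf_neq0.
have c0 : c != 0.
  apply/eqP => c0; apply: hnsq; exists (d - a).
  by rewrite /disc c0 mulr0 addr0.
have muA : mu%:A != 0 :> K by rewrite -in_algE fmorph_eq0.
set s : K := sqrtD / mu%:A.
have sE : sqrtD = mu%:A * s by rewrite mulrC divfK.
have hs : s ^+ 2 = (disc a b c d / mu ^+ 2)%:A.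
  have [h _] := hsqrtD.
  by rewrite expr_div_n h -[RHS]in_algE rmorphM fmorphV rmorphXn.
have span (v : K) : exists x y : Q2, v = x%:A + y%:A * s.
  have [x [y ->]] := generating_sqrt_span hsqrtD v.
  exists x, (y * mu); rewrite sE mulrA; congr (_ + _ * _).
  by rewrite -!in_algE rmorphM.
clearbody s.
have e2 := ramification_index2 habsK hD hs span he.
set T := (a + d) / mu.
have tE : (a + d)%:A = mu%:A * T%:A :> K.
  by rewrite -!in_algE -rmorphM /T mulrC divfK.
have aM : 0 < absK mu%:A by rewrite (absK_gt0 habsK).
have aT : absK T%:A = ratr (padic_abs T) := absK_alg habsK T.
have s0 : 0 < absK s := absK_root_gt0 habsK hD hs.
have a2 : absK 2 = 2^-1.
  have -> : (2 : K) = 2%:A by rewrite -in_algE rmorph_nat.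
  by rewrite (absK_alg habsK) padic_abs2 fmorphV rmorph_nat.
have lamE : lambda a d sqrtD = (T%:A + s) / (T%:A - s).
  rewrite /lambda tE sE -mulrDr -mulrBr -mulf_div divff//.
  by rewrite mul1r.
have neq : absK sqrtD != absK (a + d)%:A.
  rewrite sE tE !(absKM habsK) aT; apply/eqP => /(mulfI (lt0r_neq0 aM))/eqP.
  by apply/negP; exact: (absK_root_neq habsK hD hs).
have subN0 : T%:A - s != 0.
  apply/eqP => /eqP; rewrite subr_eq0 => /eqP Ts; move: neq.
  by rewrite sE tE Ts eqxx.
have lt1E : (absK sqrtD < absK (a + d)%:A) = (absK s < ratr (padic_abs T)).
  by rewrite sE tE !(absKM habsK) aT ltr_pM2l.
have lt2E : (absK (a + d)%:A < absK sqrtD) = (ratr (padic_abs T) < absK s).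
  by rewrite sE tE !(absKM habsK) aT ltr_pM2l.
rewrite lt1E lt2E e2 lamE.
(* Since [absK s] lies between [2^-1] and [1], this separates the cases [absK s < absK T%:A] and
   [absK T%:A < absK s]. *)
have [T1|T1] := leP 1 (padic_abs T).
  have sT := absK_root_lt habsK hD hs T1.
  have T0 : T != 0 by rewrite -padic_abs_gt0 (lt_le_trans _ T1).
  have [|k kE] := padic_abs_le1_ex (invr_neq0 T0).
    by rewrite padic_absV invf_le1 ?(lt_le_trans _ T1).
  have [dec conj] := @mobius_dynamics a b c d mu c0 mu0 hD false T^-1 k kE (mulfV T0).
  split=> //; last by move=> Ts; have := lt_trans sT Ts; rewrite ltxx.
  move=> _; exists (2 ^ k.+1)%N => //.
  apply: (component_count habsK hD hs).
  (* The denominator has the size of [T], and the inverse of [T] has absolute value [2 ^- k]. *)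
  have -> : (T%:A + s) / (T%:A - s) - 1 = 2 * s / (T%:A - s) by field.
  have den : absK (T%:A - s) = ratr (padic_abs T).
    by rewrite -aT; apply: (absKD_dom habsK); rewrite (absKN habsK) aT.
  rewrite !(absKM habsK) (absKV habsK) den a2 [2^-1 * _]mulrC; congr (_ * _).
  by rewrite -fmorphV -padic_absV kE fmorphV rmorphXn rmorph_nat.
have Ts := absK_root_gt habsK hD hs T1.
(* If [T = 0] then [lambda] is [-1], a root of unity of order 2. *)
have T0 : T != 0.
  apply/eqP => T0; have := hlambda 2%N isT.
  by rewrite lamE T0 scale0r add0r sub0r invrN mulrN divff
    ?sqrrN ?expr1n ?eqxx// -(absK_gt0 habsK).
have D0 := padic_abs_half_neq0 hD.
set D := disc a b c d / mu ^+ 2 in hD hs D0 *.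
have [|k kE] := padic_abs_le1_ex (mulf_neq0 T0 (invr_neq0 D0)).
  rewrite padic_abs_div hD invrK -ler_pdivlMr//.
  by rewrite -[X in X / 2]padic_abs1 padic_abs_gap// padic_abs1.
have hT : T = D * (T / D) by rewrite mulrC divfK.
have [dec conj] := @mobius_dynamics a b c d mu c0 mu0 hD true (T / D) k kE hT.
split=> //; first by move=> sT; have := lt_trans sT Ts; rewrite ltxx.
move=> _; exists (2 ^ k.+1)%N => //.
apply: (component_count habsK hD hs).
(* The denominator now has the size of [s], and [T = D * u] with [u = T / D] contributes
   [absK s ^+ 2 * 2 ^- k]. *)
have -> : (T%:A + s) / (T%:A - s) + 1 = 2 * T%:A / (T%:A - s) by field.
have den : absK (T%:A - s) = absK s.
  rewrite addrC -[RHS](absKN habsK); apply: (absKD_dom habsK).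
  by rewrite (absKN habsK) aT.
rewrite !(absKM habsK) (absKV habsK) den aT.
have ssq := absK_root_sqr habsK hD hs.
rewrite a2 hT padic_absM hD kE !rmorphM !fmorphV rmorphXn /= rmorph_nat.
apply: (mulIf (lt0r_neq0 s0)); rewrite divfK ?lt0r_neq0//.
rewrite mulrAC [absK s * _ * _]mulrAC ssq -mulrA.
by [].
Qed.
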